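(* Let $X=\{X(t),t\in\mathbb{R}^N\}$ be a separable, centered, real-valued Gaussian random field with stationary increments and spectral density $f$. Suppose there are positive constants $c_1,c_2,c_3,\gamma$ and $(\beta_1,\dots,\beta_N)\in(0,\infty)^N$ with $\gamma>\sum_{j=1}^N\frac1{\beta_j}$ such that $$\frac{c_1}{\big(\sum_{j=1}^N|\lambda_j|^{\beta_j}\big)^{\gamma}}\le f(\lambda)\le\frac{c_2}{\big(\sum_{j=1}^N|\lambda_j|^{\beta_j}\big)^{\gamma}}\qquad\text{for all }\lambda\in\mathbb{R}^N\text{ with }|\lambda|\ge c_3 .$$ (i) If for some $j\in\{1,\dots,N\}$ $$\beta_j\Big(\gamma-\sum_{i=1}^N\frac1{\beta_i}\Big)>2,$$ then $X$ has a version $\widetilde X$ with continuous sample functions such that its $j$-th partial derivative $\widetilde X'_j(t)$ is continuous almost surely. (ii) If the inequality in (i) holds for all $j\in\{1,\dots,N\}$, then $X$ has a version $\widetilde X$ which is continuously differentiable in the following sense: with probability $1$, $$\lim_{h\to0}\frac{\widetilde X(t+hu)-\widetilde X(t)-hu^T\nabla_{\widetilde X}(t)}{h}=0\qquad\text{for all unit vectors }u\in\mathbb{R}^N\text{ and all }t\in\mathbb{R}^N .$$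
   Context: $X$ satisfies $X(0)=0$ and has a continuous covariance function given by $\mathbb{E}[X(s)X(t)]=\int_{\mathbb{R}^N}(e^{i\langle s,\lambda\rangle}-1)(e^{-i\langle t,\lambda\rangle}-1)f(\lambda)\,d\lambda$, where $f\ge0$ is an even measurable function with $\int_{\mathbb{R}^N}\frac{|\lambda|^2}{1+|\lambda|^2}f(\lambda)\,d\lambda<\infty$; $f$ is called the spectral density of $X$. A version of $X$ is a random field $\widetilde X$ with $\mathbb{P}(\widetilde X(t)=X(t))=1$ for every $t$. $\nabla_{\widetilde X}(t)=(\widetilde X'_1(t),\dots,\widetilde X'_N(t))^T$ is the vector of (sample path) first-order partial derivatives of $\widetilde X$. *)

(* Defs.v *)
From HB Require Import structures.
From mathcomp Require Import all_boot all_order all_algebra.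
From mathcomp Require Import complex.
From mathcomp Require Import all_classical all_reals all_analysis.

Set Implicit Arguments.
Unset Strict Implicit.
Unset Printing Implicit Defensive.

Import Order.TTheory GRing.Theory Num.Theory.
Import numFieldNormedType.Exports.

Local Open Scope classical_set_scope.
Local Open Scope ring_scope.

(** * Lebesgue measure on R^n

   R^n is carried by [n.-tuple R] for measure theory (the library equips it
   with the product sigma-algebra, which is the Borel one) and by ['rV[R]_n]
   for topology and differentiation; [row_of_tuple] identifies the two. *)

Definition row_of_tuple (R : Type) n (x : n.-tuple R) : 'rV[R]_n :=
  \row_j tnth x j.

Definition tuple_cons (R : Type) n (p : R * n.-tuple R) : n.+1.-tuple R :=
  [tuple of p.1 :: p.2].

Fixpoint lebesgue_tuple (R : realType) (n : nat) :
    set (n.-tuple R) -> \bar R :=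
  match n with
  | 0 => dirac [tuple]
  | m.+1 => fun A =>
      product_measure1 (@lebesgue_measure R) (@lebesgue_tuple R m)
        (@tuple_cons R m @^-1` A)
  end.
Arguments lebesgue_tuple : clear implicits.

Section lebesgue_tuple_succ.
Context {R : realType} (n : nat).
Variable m : {sigma_finite_measure set (n.-tuple R) -> \bar R}.

Lemma measurable_tuple_cons :
  measurable_fun [set: R * n.-tuple R] (@tuple_cons R n).
Proof. exact: measurable_cons. Qed.

Let mu : {measure set _ -> \bar R} :=
  product_measure1 (@lebesgue_measure R) m.
Let nu : set (n.+1.-tuple R) -> \bar R := pushforward mu (@tuple_cons R n).

Let nu0 : nu set0 = 0%E.
Proof. by rewrite /nu /pushforward preimage_set0 measure0. Qed.

Let nu_ge0 A : (0 <= nu A)%E.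
Proof. exact: (measure_ge0 mu). Qed.

Let nu_sigma_additive : semi_sigma_additive nu.
Proof.
have mc := measurable_tuple_cons.
move=> F mF tF mUF; rewrite /nu /pushforward preimage_bigcup.
apply: measure_semi_sigma_additive.
- by move=> k; rewrite -[X in measurable X]setTI; exact: mc.
- apply/trivIsetP => /= i j _ _ ij; rewrite -preimage_setI.
  by move/trivIsetP : tF => /(_ _ _ _ _ ij) ->//; rewrite preimage_set0.
- by rewrite -preimage_bigcup -[X in measurable X]setTI; exact: mc.
Qed.

HB.instance Definition _ := isMeasure.Build _ _ _ nu
  nu0 nu_ge0 nu_sigma_additive.

Let nu_sigma_finite : sigma_finite setT nu.
Proof.
have /sigma_finiteP[F [TF ndF Foo]] := sigma_finiteT (@lebesgue_measure R).
have /sigma_finiteP[G [TG ndG Goo]] := sigma_finiteT m.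
exists (fun k => [set x | F k (thead x) /\ G k [tuple of behead x]]).
  apply/seteqP; split => // x _.
  have [k _ Fkx] : (\bigcup_k F k) (thead x) by rewrite -TF.
  have [l _ Glx] : (\bigcup_k G k) [tuple of behead x] by rewrite -TG.
  exists (maxn k l) => //; split.
    by move: Fkx; exact/subsetPset/ndF/leq_maxl.
  by move: Glx; exact/subsetPset/ndG/leq_maxr.
move=> k; have [mFk Fkoo] := Foo k; have [mGk Gkoo] := Goo k; split.
  apply: measurableI.
    by rewrite -[X in measurable X]setTI; exact: measurable_tnth.
  by rewrite -[X in measurable X]setTI; exact: measurable_behead.
rewrite /nu /pushforward (_ : _ @^-1` _ = F k `*` G k); last first.
  have E x t : [tuple of behead (tuple_cons (x, t))] = t :> n.-tuple R.
    exact/val_inj.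
  by apply/seteqP; split => -[x t]; rewrite /= E theadE.
by rewrite /mu /= product_measure1E// lte_mul_pinfty// ge0_fin_numE.
Qed.

HB.instance Definition _ := Measure_isSigmaFinite.Build _ _ _ nu
  nu_sigma_finite.

Lemma sigma_finite_measure_tuple_succ :
  exists m' : {sigma_finite_measure set (n.+1.-tuple R) -> \bar R},
    m' = pushforward mu (@tuple_cons R n) :> (set _ -> _).
Proof. by exists nu. Qed.

End lebesgue_tuple_succ.

Lemma sigma_finite_measure_lebesgue_tuple (R : realType) (n : nat) :
  exists m : {sigma_finite_measure set (n.-tuple R) -> \bar R},
    m = lebesgue_tuple R n :> (set _ -> _).
Proof.
elim: n => [|n [m IH]].
  by exists (dirac [tuple] : {sigma_finite_measure set _ -> \bar R}).
have [m' m'E] := sigma_finite_measure_tuple_succ m.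
by exists m'; rewrite m'E /= -IH.
Qed.

Section lebesgue_tuple_instances.
Context {R : realType} (n : nat).

Let lebesgue_tuple0 : lebesgue_tuple R n set0 = 0%E.
Proof.
by have [m <-] := sigma_finite_measure_lebesgue_tuple R n; exact: measure0.
Qed.

Let lebesgue_tuple_ge0 A : (0 <= lebesgue_tuple R n A)%E.
Proof.
by have [m <-] := sigma_finite_measure_lebesgue_tuple R n; exact: measure_ge0.
Qed.

Let lebesgue_tuple_sigma_additive : semi_sigma_additive (lebesgue_tuple R n).
Proof.
have [m <-] := sigma_finite_measure_lebesgue_tuple R n.
exact: measure_semi_sigma_additive.
Qed.

HB.instance Definition _ := isMeasure.Build _ _ _ (lebesgue_tuple R n)
  lebesgue_tuple0 lebesgue_tuple_ge0 lebesgue_tuple_sigma_additive.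

Let lebesgue_tuple_sigma_finite : sigma_finite setT (lebesgue_tuple R n).
Proof.
by have [m <-] := sigma_finite_measure_lebesgue_tuple R n; exact: sigma_finiteT.
Qed.

HB.instance Definition _ := Measure_isSigmaFinite.Build _ _ _
  (lebesgue_tuple R n) lebesgue_tuple_sigma_finite.

End lebesgue_tuple_instances.

(** [lebesgue_tuple] gives boxes their volume, which characterizes it. *)
Lemma lebesgue_tuple_box (R : realType) (n : nat) (A : 'I_n -> set R) :
  (forall i, measurable (A i)) ->
  lebesgue_tuple R n [set x | forall i, A i (tnth x i)] =
  (\prod_(i < n) lebesgue_measure (A i))%E.
Proof.
elim: n A => [|n IH] A mA.
  rewrite big_ord0 /= diracE mem_set//; first by case.
rewrite big_ord_recl -IH; last by move=> i; exact: mA.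
pose B := [set x : n.-tuple R | forall i, A (lift ord0 i) (tnth x i)].
have mB : measurable B.
  rewrite (_ : B = \bigcap_(i in setT)
      ((fun x => tnth x i) @^-1` A (lift ord0 i))).
    apply: fin_bigcap_measurable => // i _.
    by rewrite -[X in measurable X]setTI; exact: measurable_tnth.
  by apply/seteqP; split => x /= h i; [move=> _|]; exact: h.
apply: (eq_trans _ (product_measure1E (@lebesgue_measure R)
  (lebesgue_tuple R n) (mA ord0) mB)) => /=.
congr (product_measure1 _ _ _); apply/seteqP; split => -[x t] /=.
  move=> h; split => [|i]; first by have := h ord0; rewrite tnth0.
  by have := h (lift ord0 i); rewrite tnthS.
move=> [h0 h] i; have [j ->|->] := unliftP ord0 i; last by rewrite tnth0.
by rewrite tnthS; exact: h.
Qed.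

(** * Euclidean structure of R^N

   The library norm on ['rV[R]_N] is the sup norm (it induces the same
   topology), so the Euclidean one is spelled out. *)

Definition dotp (R : realType) N (s t : 'rV[R]_N) : R :=
  \sum_(j < N) s 0 j * t 0 j.

Definition eucl (R : realType) N (t : 'rV[R]_N) : R := Num.sqrt (dotp t t).

Definition basis_vec (R : realType) N (j : 'I_N) : 'rV[R]_N := delta_mx 0 j.

Definition partial_derivable (R : realType) N (g : 'rV[R]_N -> R) (j : 'I_N)
  (t : 'rV[R]_N) : Prop := derivable g t (basis_vec R j).

(** ['D_v g t] is a junk value where [g] is not derivable, so [partial] and
   [gradient] are meaningful only together with [partial_derivable]. *)
Definition partial (R : realType) N (g : 'rV[R]_N -> R) (j : 'I_N)
  (t : 'rV[R]_N) : R := 'D_(basis_vec R j) g t.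

Definition gradient (R : realType) N (g : 'rV[R]_N -> R) (t : 'rV[R]_N) :
  'rV[R]_N := \row_j partial g j t.

(** * Complex exponential and complex-valued integrals over R^N

   The library only integrates real functions; the integral of a complex one
   is taken componentwise, and [expi x] is e^{ix}. *)

Definition expi (R : realType) (x : R) : R[i] := Complex (cos x) (sin x).

Definition cintegral (R : realType) N (g : 'rV[R]_N -> R[i]) : R[i] :=
  Complex
    (\int[lebesgue_tuple R N]_x complex.Re (g (row_of_tuple x)))
    (\int[lebesgue_tuple R N]_x complex.Im (g (row_of_tuple x))).

(** * Random fields *)

Section random_fields.
Context {R : realType} {d : measure_display} {T : measurableType d}.
Variable P : probability T R.

(** [normal_prob m 0] is not the degenerate Gaussian law in the library, hence
   the case distinction. *)
Definition gaussian_law (m s : R) (A : set R) : \bar R :=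
  if s == 0 then dirac m A else normal_prob m s A.

Definition gaussian_rv (Y : T -> R) : Prop :=
  exists m s : R, 0 <= s /\
    forall A : set R, measurable A -> P (Y @^-1` A) = gaussian_law m s A.

Section fields.
Context {N : nat}.
Implicit Types X : 'rV[R]_N -> {RV P >-> R}.

Definition gaussian_field X : Prop :=
  forall (n : nat) (a : 'I_n -> R) (t : 'I_n -> 'rV[R]_N),
    gaussian_rv (fun w => \sum_(k < n) a k * X (t k) w).

Definition centered X : Prop := forall t, ('E_P[X t] = 0)%E.

(** Equality of all finite-dimensional distributions of
   [X(h + .) - X(h)] and [X(.) - X(0)], for every [h]. *)
Definition stationary_increments X : Prop :=
  forall (h : 'rV[R]_N) (n : nat) (t : 'I_n -> 'rV[R]_N)
      (A : set (n.-tuple R)), measurable A ->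
    P [set w | A [tuple X (h + t k) w - X h w | k < n]] =
    P [set w | A [tuple X (t k) w - X 0 w | k < n]].

(** Separability in the sense of Doob: off the null set [L], the path lies in
   [F] on [G] as soon as it does on [G `&` D] (the converse is trivial). *)
Definition separable_field X : Prop :=
  exists (D : set 'rV[R]_N) (L : set T),
    [/\ countable D, dense D, P.-negligible L &
      forall (G : set 'rV[R]_N) (F : set R), open G -> closed F ->
        [set w | forall t, (G `&` D) t -> F (X t w)] `\`
        [set w | forall t, G t -> F (X t w)] `<=` L].

Definition covariance_fun X (s t : 'rV[R]_N) : R :=
  fine 'E_P[(fun w => X s w * X t w)%R]%E.

(** The integrability condition makes the (complex) covariance integral
   absolutely convergent. Measurability is Borel measurability. *)
Definition spectral_density X (f : 'rV[R]_N -> R) : Prop :=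
  [/\ forall l, 0 <= f l,
      forall l, f (- l) = f l,
      measurable_fun [set: N.-tuple R] (fun x => f (row_of_tuple x)),
      (\int[lebesgue_tuple R N]_x
         (let l := row_of_tuple x in
          eucl l ^+ 2 / (1 + eucl l ^+ 2) * f l)%:E < +oo)%E &
      forall s t : 'rV[R]_N,
        real_complex R (covariance_fun X s t) =
        cintegral (fun l => (expi (dotp s l) - 1) * (expi (- dotp t l) - 1) *
                            real_complex R (f l))].

Definition is_version X (Y : 'rV[R]_N -> {RV P >-> R}) : Prop :=
  forall t, P [set w | Y t w = X t w] = 1%E.

End fields.
End random_fields.

Definition sample_path {R : realType} {d : measure_display}
  {T : measurableType d} {P : probability T R} {N : nat}
  (X : 'rV[R]_N -> {RV P >-> R}) (w : T) : 'rV[R]_N -> R := fun t => X t w.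

(* Main.v *)
(** The integral of the spectral density controls second moments of all linear
   combinations of values of X, and a Gaussian variable has tails governed by
   its second moment alone; Kolmogorov's chaining argument along dyadic grids
   then yields continuous versions of fields whose neighbouring grid increments
   have second moments decaying geometrically.

   This is applied twice: to X itself, and, for an admissible direction e_j, to
   the field of divided differences (t, h) |-> (X(t + h e_j) - X(t)) / h on
   R^(N+1), whose spectral integrand is dominated by lambda_j^2 f(lambda)
   uniformly in h.  If Y is the continuous version of X, the continuous version
   W of the second field satisfies Y(t + h e_j) - Y(t) = h W(t, h) on a
   countable dense set, hence everywhere by continuity.  Therefore
   W(t, 0) is the j-th partial derivative of Y, without any mean-square
   derivative having been introduced, and the joint continuity of W gives (i)
   and, changing one coordinate at a time, (ii). *)

From HB Require Import structures.
Require Import Defs.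
From mathcomp Require Import all_boot all_order all_algebra.
From mathcomp Require Import complex zify ring lra.
From mathcomp Require Import all_classical all_reals all_analysis.
From mathcomp Require Import measurable_realfun.

Set Implicit Arguments.
Unset Strict Implicit.
Unset Printing Implicit Defensive.

Import Order.TTheory GRing.Theory Num.Theory.
Import numFieldNormedType.Exports.
Local Open Scope classical_set_scope.
Local Open Scope ring_scope.

(** * Gaussian tails *)

(** Chaining needs only some geometric decay of second moments: a Gaussian tail can be traded for
    any power of the ratio of variance to squared threshold, and a high enough power beats the
    number of grid cells, whatever the rate and the dimension. The spectral side therefore only has
    to gain a small power. It is paid for by a strict gap [theta < gamma - Q], where [Q], the sum of
    the 1/beta_j, is the homogeneous dimension of [aniso] and the integrand carries a weight of
    order [aniso] to the power [theta]: 0 for X, and [2 / beta j] for divided differences, which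
    turns the gap into the hypothesis on j.

    The obstacle is h = 0, where the quotient has no meaning but where its continuous version is
    wanted. The grid in h is shifted by 1/3 so as never to meet it, and the identity between the two
    versions is kept multiplied by h, so that it extends from the grid to all points. *)

Section gaussian_tails.
Context {R : realType}.
Implicit Types m s b w : R.

(** Exponential tilting: the exponential weight turns the density of mean [m] into [c] times the
    density of mean [m + b * s ^+ 2], whose total mass is 1. *)
Lemma normal_prob_chernoff m s b w : s != 0 ->
  (normal_prob m s [set x : R | (w <= b * (x - m))%R] <=
   (expR (b ^+ 2 * s ^+ 2 / 2 - w))%:E)%E.
Proof.
move=> s0; rewrite /normal_prob.
set A := [set x | _].
have mA : measurable A.
  rewrite -[A]setTI; apply: measurable_fun_le => //.
  by apply: measurable_funM => //; exact: measurable_funB.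
pose c := expR (b ^+ 2 * s ^+ 2 / 2 - w).
have E x : expR (b * (x - m) - w) * normal_pdf m s x =
           c * normal_pdf (m + b * s ^+ 2) s x.
  rewrite /c !normal_pdfE// /normal_fun !(mulrCA _ (normal_peak s)) -!expRD.
  by congr (_ * expR _); field.
apply: (@le_trans _ _ (\int[lebesgue_measure]_(x in A)
    (c%:E * (normal_pdf (m + b * s ^+ 2) s x)%:E))%E).
  apply: ge0_le_integral => //=.
  - by move=> x _; rewrite lee_fin normal_pdf_ge0.
  - by apply/measurable_funTS/measurable_EFinP; exact: measurable_normal_pdf.
  - apply/measurable_funTS/measurable_EFinP/measurable_funM => //.
    exact: measurable_normal_pdf.
  - move=> x Ax; rewrite -EFinM -E lee_fin ler_peMl ?normal_pdf_ge0//.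
    by rewrite -expR0 ler_expR subr_ge0.
have mpdf : measurable_fun setT
    (fun x => (normal_pdf (m + b * s ^+ 2) s x)%:E).
  by apply/measurable_EFinP; exact: measurable_normal_pdf.
apply: (@le_trans _ _ (\int[lebesgue_measure]_x
    (c%:E * (normal_pdf (m + b * s ^+ 2) s x)%:E))%E).
  apply: ge0_subset_integral => //.
    by apply/measurable_EFinP/measurable_funM => //; exact: measurable_normal_pdf.
  by move=> x _; rewrite -EFinM lee_fin mulr_ge0 ?expR_ge0 ?normal_pdf_ge0.
rewrite ge0_integralZl//; first by rewrite integral_normal_pdf mule1.
- by move=> x _; rewrite lee_fin normal_pdf_ge0.
- by rewrite lee_fin expR_ge0.
Qed.

Lemma gaussian_law_chernoff m s b w : 0 <= s ->
  (gaussian_law m s [set x : R | (w <= b * (x - m))%R] <=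
   (expR (b ^+ 2 * s ^+ 2 / 2 - w))%:E)%E.
Proof.
move=> s0; rewrite /gaussian_law; case: eqP => [->|/eqP sN0].
  rewrite diracE lee_fin; case: (boolP (_ \in _)) => [|_]; last exact: expR_ge0.
  rewrite inE /= subrr mulr0 => w0.
  by rewrite expr0n /= mulr0 mul0r sub0r -[leLHS]expR0 ler_expR oppr_ge0.
exact: normal_prob_chernoff.
Qed.

(** A lower bound, free of [m] and [s], for the mass between one and two standard deviations on one
    side of the mean: an interval of length [s] times the density at distance [2 * s]. *)
Definition sigma_tail : R := expR (- 2) / Num.sqrt (pi *+ 2).

Lemma sigma_tail_gt0 : 0 < sigma_tail.
Proof. by rewrite divr_gt0 ?expR_gt0// sqrtr_gt0 mulrn_wgt0// pi_gt0. Qed.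

Lemma sigma_tail_le1 : sigma_tail <= 1.
Proof.
rewrite /sigma_tail ler_pdivrMr; last by rewrite sqrtr_gt0 mulrn_wgt0// pi_gt0.
rewrite mul1r.
apply: (@le_trans _ _ 1); first by rewrite -[leRHS]expR0 ler_expR oppr_le0.
rewrite -[leLHS]sqrtr1 ler_sqrt; last by rewrite mulrn_wge0// pi_ge0.
rewrite -mulr_natr; have := pi_ge2 R; lra.
Qed.

Lemma normal_prob_sigma_tail m s b : 0 < s -> b ^+ 2 = 1 ->
  (sigma_tail%:E <= normal_prob m s [set x : R | (s <= b * (x - m))%R])%E.
Proof.
move=> s0 b1; rewrite /normal_prob.
(* Left end of [[m + s, m + 2 * s]] when [b = 1], and of [[m - 2 * s, m - s]] when [b = -1]. *)
pose l : R := Num.min (m + b * s) (m + b * (2 * s)).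
pose I : set R := `[l, l + s]%classic.
have bE : b = 1 \/ b = -1.
  by move/eqP: b1; rewrite sqrf_eq1 => /orP[/eqP|/eqP]; [left|right].
have Ix x : x \in `[l, l + s] -> s <= b * (x - m) <= 2 * s.
  rewrite in_itv /= /l; case: bE => ->.
    rewrite !mul1r min_l; last by lra.
    by move=> /andP[? ?]; apply/andP; split; lra.
  rewrite !mulN1r min_r; last by lra.
  by move=> /andP[? ?]; apply/andP; split; lra.
have mI : measurable I by exact: measurable_itv.
set A := [set x | _].
have mA : measurable A.
  rewrite -[A]setTI; apply: measurable_fun_le => //.
  by apply: measurable_funM => //; exact: measurable_funB.
have mpdf D : measurable_fun D (fun x => (normal_pdf m s x)%:E).
  by apply/measurable_funTS/measurable_EFinP; exact: measurable_normal_pdf.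
apply: (@le_trans _ _
    (\int[lebesgue_measure]_(x in I) (normal_pdf m s x)%:E)%E); last first.
  apply: ge0_subset_integral => //; first exact: mpdf.
    by move=> x _; rewrite lee_fin normal_pdf_ge0.
  by move=> x /= /Ix /andP[].
apply: (@le_trans _ _
    (\int[lebesgue_measure]_(x in I) (normal_peak s * expR (- 2))%:E)%E); last first.
  apply: ge0_le_integral => //=.
  - by move=> x _; rewrite lee_fin mulr_ge0 ?normal_peak_ge0 ?expR_ge0.
  - exact: mpdf.
  - move=> x /Ix /andP[x1 x2]; rewrite lee_fin normal_pdfE ?gt_eqF//.
    rewrite ler_wpM2l ?normal_peak_ge0// ler_expR mulNr lerN2.
    rewrite ler_pdivrMr; last by rewrite mulrn_wgt0// exprn_gt0.
    have -> : (x - m) ^+ 2 = (b * (x - m)) ^+ 2 by rewrite exprMn b1 mul1r.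
    have : (b * (x - m)) ^+ 2 <= (2 * s) ^+ 2 by rewrite ler_sqr ?nnegrE; lra.
    rewrite exprMn; lra.
rewrite integral_cst//= lebesgue_measure_itv/= lte_fin ltrDl s0.
rewrite -EFinD -EFinM lee_fin /sigma_tail /normal_peak addrAC subrr add0r.
rewrite -mulrnAr sqrtrM ?sqr_ge0// sqrtr_sqr gtr0_norm//.
rewrite invfM -!mulrA mulrCA [expR _ * s]mulrC mulKf ?gt_eqF// [leRHS]mulrC.
exact: lexx.
Qed.

Lemma gaussian_law_sigma_tail m s b : 0 <= s -> b ^+ 2 = 1 ->
  (sigma_tail%:E <= gaussian_law m s [set x : R | (s <= b * (x - m))%R])%E.
Proof.
move=> s0 b1; rewrite /gaussian_law; case: eqP => [->|/eqP sN0].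
  by rewrite diracE mem_set/= ?lee_fin ?sigma_tail_le1// subrr mulr0.
by apply: normal_prob_sigma_tail => //; rewrite lt_neqAle eq_sym sN0.
Qed.

Lemma expRN_le_fact (x : R) q : 0 < x -> expR (- x) <= q`!%:R / x ^+ q.
Proof.
move=> x0; rewrite expRN ler_pdivlMr ?exprn_gt0// mulrC ler_pdivrMr ?expR_gt0//.
case: q => [|q]; first by rewrite expr0 mul1r -expR0 ler_expR ltW.
have := expR_ge1Dxn q (ltW x0) => h.
have f0 : (0 : R) < q.+1`!%:R by rewrite ltr0n fact_gt0.
have : x ^+ q.+1 / q.+1`!%:R <= expR x by lra.
by rewrite ler_pdivrMr// mulrC.
Qed.

(** The 2 counts the two one-sided tails, the factorial comes from [expRN_le_fact], and
    [8 / sigma_tail] from the exponent [u ^+ 2 / (8 * A)] with [A = v / sigma_tail]. *)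
Definition tail_cst (q : nat) : R := 2 * (q`!%:R * (8 / sigma_tail) ^+ q).

Lemma tail_cst_gt0 q : 0 < tail_cst q.
Proof.
by rewrite !mulr_gt0// ?ltr0n ?fact_gt0// exprn_gt0// divr_gt0// sigma_tail_gt0.
Qed.

End gaussian_tails.
Arguments sigma_tail : clear implicits.
Arguments tail_cst : clear implicits.

(** * Gaussian variables controlled by their second moment *)

Section gaussian_rv.
Context {R : realType} {d : measure_display} {T : measurableType d}.
Context {P : probability T R}.
Implicit Type Y : {RV P >-> R}.

Lemma measurable_rv_le Y (u b c : R) :
  measurable [set w | u <= b * (Y w - c)].
Proof.
rewrite -[X in measurable X]setTI; apply: measurable_fun_le => //.
by apply: measurable_funM => //; exact: measurable_funB.
Qed.

Lemma gaussian_law_rv Y (m s : R) (u b c : R) :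
  (forall A : set R, measurable A -> P (Y @^-1` A) = gaussian_law m s A) ->
  P [set w | u <= b * (Y w - c)] = gaussian_law m s [set x | u <= b * (x - c)].
Proof.
move=> <-//; rewrite -[X in measurable X]setTI; apply: measurable_fun_le => //.
by apply: measurable_funM => //; exact: measurable_funB.
Qed.

(* |Y| >= |m| + s has probability at least [sigma_tail], so the second moment
   controls both parameters of the law without computing any moment. *)
Lemma gaussian_second_moment Y (m s : R) : 0 <= s ->
  (forall A : set R, measurable A -> P (Y @^-1` A) = gaussian_law m s A) ->
  ((sigma_tail R * (`|m| + s) ^+ 2)%:E <= 'E_P[fun w => (Y w ^+ 2)%R])%E.
Proof.
move=> s0 lawY.
(* [b] is the sign of the mean: a deviation of [s] on that side brings [|Y|] to at least
   [|m| + s]. *)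
pose b : R := if 0 <= m then 1 else -1.
have b1 : b ^+ 2 = 1 by rewrite /b; case: ifP => _; rewrite ?sqrrN expr1n.
have bm : b * m = `|m|.
  rewrite /b; case: ifPn => m0; first by rewrite mul1r ger0_norm.
  by rewrite mulN1r ltr0_norm// ltNge.
have := gaussian_law_sigma_tail m s0 b1; rewrite -(gaussian_law_rv _ _ _ lawY).
set A := [set w | _] => PA.
have mA : measurable A by exact: measurable_rv_le.
apply: (@le_trans _ _ (\int[P]_(w in A) ((`|m| + s) ^+ 2)%:E)%E).
  by rewrite integral_cst// mulrC EFinM lee_pmul// lee_fin ?sqr_ge0 ?ltW
      ?sigma_tail_gt0.
have mY2 : measurable_fun setT (fun w => (Y w ^+ 2)%:E).
  by apply/measurable_EFinP; exact: measurable_funX.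
rewrite unlock.
apply: (@le_trans _ _ (\int[P]_(w in A) (Y w ^+ 2)%:E)%E); last first.
  by apply: ge0_subset_integral => // w _; rewrite lee_fin sqr_ge0.
apply: ge0_le_integral => //=.
- by move=> w _; rewrite lee_fin sqr_ge0.
- exact: measurable_funTS.
- move=> w; rewrite /A /= lee_fin => h.
  rewrite -[leRHS]mul1r -b1 -exprMn ler_sqr ?nnegrE ?addr_ge0//.
    by rewrite -bm; move: h; rewrite mulrBr; lra.
  by move: h; rewrite mulrBr bm; have := normr_ge0 m; lra.
Qed.

(** When [u ^+ 2 < 4 * A] the right-hand side is at least 1; otherwise [|m| <= u / 2], and
    [|Y| >= u] forces a deviation of [u / 2] from the mean. *)
Lemma gaussian_law_tail Y (m s A u : R) : 0 <= s ->
  (forall B : set R, measurable B -> P (Y @^-1` B) = gaussian_law m s B) ->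
  0 < A -> (`|m| + s) ^+ 2 <= A -> 0 <= u ->
  (P [set w | (u <= `|Y w|)%R] <= (2 * expR (- (u ^+ 2 / (8 * A))))%:E)%E.
Proof.
move=> s0 lawY A0 msA u0.
have mB : measurable [set w | u <= `|Y w|].
  rewrite -[X in measurable X]setTI; apply: measurable_fun_le => //.
  exact: measurableT_comp.
set y := u ^+ 2 / (8 * A).
have [small|big] := ltP (u ^+ 2) (4 * A).
  apply: (le_trans (probability_le1 _ mB)).
  rewrite lee_fin; have := expR_ge1Dx (- y).
  suff : y <= 2^-1 by lra.
  by rewrite ler_pdivrMr ?mulr_gt0//; lra.
have sA : s ^+ 2 <= A.
  apply: le_trans msA; rewrite ler_sqr ?nnegrE ?addr_ge0//.
  by rewrite lerDr.
have mu : `|m| <= u / 2.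
  have u20 : 0 <= u / 2 by rewrite divr_ge0.
  rewrite -ler_sqr ?nnegrE//.
  have : `|m| ^+ 2 <= A.
    apply: le_trans msA; rewrite ler_sqr ?nnegrE ?addr_ge0//.
    by rewrite lerDl.
  by rewrite exprMn exprVn -natrX; lra.
have half (b : R) : b ^+ 2 = 1 ->
    (P [set w | (u / 2 <= b * (Y w - m))%R] <= (expR (- y))%:E)%E.
  (* [a] minimises the Chernoff exponent [a ^+ 2 * A / 2 - a * (u / 2)]. *)
  move=> b1; pose a := u / (2 * A).
  have a0 : 0 < a.
    rewrite divr_gt0 ?mulr_gt0// lt_neqAle u0 andbT eq_sym; apply/eqP => u00.
    by move: big; rewrite u00 expr0n/= leNgt mulr_gt0.
  have -> : [set w | u / 2 <= b * (Y w - m)] =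
            [set w | a * (u / 2) <= (a * b) * (Y w - m)].
    by apply/seteqP; split => w /=; rewrite -mulrA ler_pM2l.
  rewrite (gaussian_law_rv _ _ _ lawY).
  apply: le_trans (gaussian_law_chernoff _ _ _ s0) _.
  rewrite lee_fin ler_expR exprMn b1 mulr1.
  have -> : - y = a ^+ 2 * A / 2 - a * (u / 2).
    by rewrite /y /a; field; rewrite gt_eqF.
  by rewrite lerD2r ler_pM2r// ler_pM2l// exprn_gt0.
have AB : [set w | u <= `|Y w|] `<=`
    [set w | u / 2 <= 1 * (Y w - m)] `|` [set w | u / 2 <= -1 * (Y w - m)].
  move=> w /=; have : m <= u / 2 /\ - m <= u / 2.
    by move: mu; rewrite ler_norml => /andP[? ?]; split; lra.
  move=> [? ?]; have [Y0|Y0] := lerP 0 (Y w).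
    by rewrite ger0_norm// => ?; left; lra.
  by rewrite ltr0_norm// => ?; right; lra.
apply: (@le_trans _ _ (P ([set w | u / 2 <= 1 * (Y w - m)] `|`
                          [set w | u / 2 <= -1 * (Y w - m)]))).
  apply: le_measure => //; rewrite inE//.
  by apply: measurableU; exact: measurable_rv_le.
apply: (le_trans (measureU2 _ _ _)); [exact: measurable_rv_le..|].
by rewrite mulr_natl mulr2n EFinD leeD// half// ?expr1n// sqrrN expr1n.
Qed.

Lemma gaussian_tail Y (v u : R) (q : nat) : gaussian_rv P Y ->
  ('E_P[fun w => (Y w ^+ 2)%R] <= v%:E)%E -> 0 < v -> 0 < u ->
  (P [set w | (u <= `|Y w|)%R] <= (tail_cst R q * (v / u ^+ 2) ^+ q)%:E)%E.
Proof.
move=> [m [s [s0 lawY]]] EY v0 u0.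
have c0 := @sigma_tail_gt0 R.
have := le_trans (gaussian_second_moment s0 lawY) EY; rewrite lee_fin => ms.
pose A := v / sigma_tail R.
have A0 : 0 < A by rewrite divr_gt0.
have msA : (`|m| + s) ^+ 2 <= A by rewrite ler_pdivlMr// mulrC.
apply: (le_trans (gaussian_law_tail s0 lawY A0 msA (ltW u0))).
set y := u ^+ 2 / (8 * A).
have y0 : 0 < y by apply: divr_gt0; [exact: exprn_gt0|exact: mulr_gt0].
rewrite lee_fin /tail_cst -!mulrA ler_pM2l//.
apply: (le_trans (expRN_le_fact q y0)).
rewrite ler_pM2l ?ltr0n ?fact_gt0// -exprVn -exprMn.
have -> : y^-1 = 8 / sigma_tail R * (v / u ^+ 2).
  by rewrite /y /A; field; rewrite !gt_eqF.
by [].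
Qed.

(** [covariance_fun] is defined with [fine], so it carries information only once second moments are
    finite. The tail of [Y ^+ 2] is compared with an exponential density, whose integral is 1. *)
Lemma gaussian_second_moment_lty Y : gaussian_rv P Y ->
  ('E_P[fun w => (Y w ^+ 2)%R] < +oo)%E.
Proof.
move=> [m [s [s0 lawY]]].
pose A := (`|m| + s) ^+ 2 + 1.
have A0 : 0 < A by rewrite ltr_wpDl// sqr_ge0.
have msA : (`|m| + s) ^+ 2 <= A by rewrite lerDl.
pose Y2 : {RV P >-> R} := (Y ^+ 2)%R.
have -> : ('E_P[fun w => (Y w ^+ 2)%R] = 'E_P[Y2])%E.
  by rewrite unlock.
rewrite ge0_expectation_ccdf; last by move=> w; exact: sqr_ge0.
pose r := (8 * A)^-1.
have r0 : 0 < r by rewrite invr_gt0 mulr_gt0.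
have mexp D : measurable_fun D (fun x : R => (exponential_pdf r x)%:E).
  apply/measurable_funTS/measurable_EFinP.
  exact: measurable_exponential_pdf.
have c0 : (0 <= (2 / r)%:E)%E by rewrite lee_fin divr_ge0// ltW.
apply: (@le_lt_trans _ _ (\int[lebesgue_measure]_x
    ((2 / r)%:E * (exponential_pdf r x)%:E))%E); last first.
  rewrite ge0_integralZl//; first by rewrite integral_exponential_pdf// mule1 ltry.
    exact: mexp.
  by move=> x _; rewrite lee_fin exponential_pdf_ge0// ltW.
apply: (@le_trans _ _ (\int[lebesgue_measure]_(x in `[0%R, +oo[)
    ((2 / r)%:E * (exponential_pdf r x)%:E))%E); last first.
  apply: ge0_subset_integral => //.
    by apply: emeasurable_funM => //; exact: mexp.
  by move=> x _; rewrite mule_ge0// lee_fin exponential_pdf_ge0// ltW.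
apply: ge0_le_integral => //=.
- by apply: measurable_funTS; exact: ccdf_measurable.
- by apply: emeasurable_funM => //; exact: mexp.
- move=> x; rewrite in_itv/= andbT => x0.
  have -> : exponential_pdf r x = r * expR (- r * x) by rewrite exponential_pdfE.
  rewrite -EFinM.
  have := gaussian_law_tail s0 lawY A0 msA (sqrtr_ge0 x).
  rewrite sqr_sqrtr// => tail.
  have -> : 2 / r * (r * expR (- r * x)) = 2 * expR (- (x / (8 * A))).
    by rewrite mulrA divfK ?gt_eqF// mulNr mulrC [r * x]mulrC mulrC.
  apply: le_trans tail; rewrite /ccdf /distribution /pushforward.
  apply: le_measure; rewrite ?inE.
  + by rewrite -[X in measurable X]setTI; exact: measurable_funP.
  + rewrite -[X in measurable X]setTI; apply: measurable_fun_le => //.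
    exact: measurableT_comp.
  + move=> w /=; rewrite in_itv/= andbT => /ltW xY.
    by rewrite -sqrtr_sqr ler_wsqrtr.
Qed.

End gaussian_rv.

(** * Dyadic chaining *)

Section geometric_increments.
Context {R : realType}.
Implicit Types (x : R^nat) (c r : R).

(** With [e n] bounding the sum of the remaining increments, [x + e] decreases and [x - e]
    increases; they squeeze [x], and their monotonicity also yields the rate. *)
Lemma geometric_increments_cvg x c r : 0 < r < 1 ->
  (forall n, `|x n.+1 - x n| <= c * r ^+ n) ->
  cvgn x /\ forall n, `|limn x - x n| <= c * r ^+ n / (1 - r).
Proof.
move=> /andP[r0 r1] xr.
have r10 : 0 < 1 - r by rewrite subr_gt0.
pose e n := c * r ^+ n / (1 - r).
have eS n : e n = e n.+1 + c * r ^+ n by rewrite /e exprS; field; rewrite gt_eqF.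
have e0 : e @ \oo --> (0 : R).
  rewrite [e](_ : _ = (fun n => (c / (1 - r)) * r ^+ n)); last first.
    by apply/funext => n; rewrite /e mulrAC.
  rewrite -[0](mulr0 (c / (1 - r))); apply: cvgM; first exact: cvg_cst.
  by apply: cvg_expr; rewrite ger0_norm// ltW.
have c0 : 0 <= c.
  by have := le_trans (normr_ge0 _) (xr 0%N); rewrite expr0 mulr1.
have e_ge0 n : 0 <= e n.
  apply: divr_ge0; last exact: ltW.
  by apply: mulr_ge0 => //; apply/exprn_ge0/ltW.
pose y n := x n + e n; pose z n := x n - e n.
have yS : {homo y : n p / (n <= p)%N >-> p <= n}.
  apply/nonincreasing_seqP => n; rewrite /y (eS n).
  by have := xr n; rewrite ler_norml => /andP[_]; lra.
have zS : {homo z : n p / (n <= p)%N >-> n <= p}.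
  apply/nondecreasing_seqP => n; rewrite /z (eS n).
  by have := xr n; rewrite ler_norml => /andP[+ _]; lra.
have cy : cvgn y.
  apply: nonincreasing_is_cvgn => //.
  exists (z 0%N) => _ [n _ <-]; apply: (le_trans (zS _ _ (leq0n n))).
  by rewrite /z /y; have := e_ge0 n; lra.
have cx : x @ \oo --> limn y.
  rewrite [x](_ : _ = y \- e); last by apply/funext => n; rewrite /y /= addrK.
  by rewrite -[limn y]subr0; apply: cvgB.
have cz : z @ \oo --> limn y by rewrite -[limn y]subr0; apply: cvgB.
have xy : limn x = limn y by exact/cvg_lim.
have zy : limn z = limn y by exact/cvg_lim.
split=> [|n]; first by apply/cvg_ex; exists (limn y).
rewrite xy ler_distl; apply/andP; split.
  by rewrite -zy; apply: nondecreasing_cvgn_le => //; apply/cvg_ex; exists (limn y).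
exact: nonincreasing_cvgn_ge.
Qed.

End geometric_increments.

Section dyadic_points.
Context {R : realType} {m : nat}.
Implicit Types (k l : 'rV[int]_m) (t s : 'rV[R]_m).

Definition dyadic n k : 'rV[R]_m := \row_i ((k 0 i)%:~R / 2 ^+ n).

Definition dyadic_floor n t : 'rV[int]_m := \row_i Num.floor (2 ^+ n * t 0 i).

Lemma dyadicS n k : dyadic n k = dyadic n.+1 (2 *: k).
Proof.
apply/rowP => i; rewrite !mxE intrM exprS.
by field; rewrite expf_neq0.
Qed.

Lemma dyadic_floor_dyadic n k : dyadic_floor n (dyadic n k) = k.
Proof.
apply/rowP => i; rewrite !mxE mulrCA divff ?expf_neq0// mulr1.
by rewrite intrKfloor.
Qed.

Lemma dyadic_floorK n p k : (n <= p)%N ->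
  dyadic p (dyadic_floor p (dyadic n k)) = dyadic n k.
Proof.
move=> /subnK <-; elim: (p - n)%N => [|q IH]; first by rewrite dyadic_floor_dyadic.
have : exists k', dyadic n k = dyadic (q + n) k' by exists (dyadic_floor (q +
    n) (dyadic n k)).
by move=> [k' ->]; rewrite addSn (dyadicS (q + n)) dyadic_floor_dyadic.
Qed.

Lemma dyadic_floor_step n t i :
  (2 *: dyadic_floor n t) 0 i <= dyadic_floor n.+1 t 0 i
    <= (2 *: dyadic_floor n t) 0 i + 1.
Proof.
rewrite !mxE exprS -mulrA; set y := 2 ^+ n * _.
have /andP[y1 y2] := floor_itv y.
apply/andP; split.
  by rewrite floor_ge_int intrM ler_pM2l.
rewrite -ltzD1 floor_lt_int !intrD intrM; move: y2; rewrite intrD; lra.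
Qed.

Lemma dyadic_floor_near n t s i : `|t 0 i - s 0 i| < 2 ^- n ->
  dyadic_floor n s 0 i <= dyadic_floor n t 0 i + 1.
Proof.
move=> ts; rewrite !mxE.
have n0 : (0 : R) < 2 ^+ n by rewrite exprn_gt0.
have /andP[t1 t2] := floor_itv (2 ^+ n * t 0 i).
have : 2 ^+ n * s 0 i < 2 ^+ n * t 0 i + 1.
  move: ts; rewrite distrC ltr_distl => /andP[_ h].
  by have := ltr_pM2l n0 (s 0 i) (t 0 i + 2 ^- n); rewrite h mulrDr divff
      ?gt_eqF// => ->.
rewrite -ltzD1 floor_lt_int !intrD; move: t2; rewrite intrD; lra.
Qed.

(** Indices of a bounded region grow like [2 ^+ n], so they eventually lie in the box of radius
    [4 ^+ n]; the [+ 1] absorbs the rounding. *)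
Lemma dyadic_floor_bound n t i (M : R) : `|t 0 i| <= M -> M + 1 <= 2 ^+ n ->
  `|dyadic_floor n t 0 i| <= 4 ^+ n.
Proof.
move=> tM Mn; rewrite !mxE -(ler_int R) intr_norm rmorphXn/=.
have n1 : (1 : R) <= 2 ^+ n by rewrite exprn_ege1// ler1n.
have /andP[t1 t2] := floor_itv (2 ^+ n * t 0 i).
have -> : (4 : R) ^+ n = 2 ^+ n * 2 ^+ n by rewrite -exprMn -natrM.
move: t2; rewrite intrD => t2.
move: tM; rewrite ler_norml => /andP[tM1 tM2].
rewrite ler_norml; apply/andP; split; nra.
Qed.

End dyadic_points.

Lemma nbhs_coord {R : realType} {m : nat} (t : 'rV[R]_m) (e : R) : 0 < e ->
  \forall s \near t, forall i : 'I_m, `|t 0 i - (s : 'rV[R]_m) 0 i| < e.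
Proof.
move=> e0; exists (fun _ i => ball (t 0 i) e).
  by move=> i j; rewrite (ord1 i); exact: nbhsx_ballx.
by move=> s /= ts i; exact: ts.
Qed.

Section chaining.
Context {R : realType} {m : nat} (r : R).
Hypothesis r01 : 0 < r < 1.
Implicit Types (u : 'rV[R]_m -> R) (k l : 'rV[int]_m) (t s : 'rV[R]_m).

Definition small_increments u n := forall k (i : 'I_m),
  (forall i', `|k 0 i'| <= 4 ^+ n) ->
  `|u (dyadic n (k + delta_mx 0 i)) - u (dyadic n k)| <= r ^+ n.

Let r0 : 0 < r. Proof. by case/andP: r01. Qed.

(** The walk replaces the coordinates of [k] by those of [l] one after the other; the mixed points
    [p a] stay in the box because each of their coordinates is one of [k] or of [l]. *)
Lemma small_increments_walk u n k l : small_increments u n ->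
  (forall i, k 0 i <= l 0 i <= k 0 i + 1) ->
  (forall i, `|k 0 i| <= 4 ^+ n) -> (forall i, `|l 0 i| <= 4 ^+ n) ->
  `|u (dyadic n l) - u (dyadic n k)| <= m%:R * r ^+ n.
Proof.
move=> un kl kn ln.
pose p a : 'rV[int]_m := \row_i (if (i < a)%N then l 0 i else k 0 i).
have pm : p m = l by apply/rowP => i; rewrite mxE ltn_ord.
have pn a i : `|p a 0 i| <= 4 ^+ n by rewrite mxE; case: ifP.
suff H a : (a <= m)%N ->
    `|u (dyadic n (p a)) - u (dyadic n k)| <= a%:R * r ^+ n.
  by have := H m (leqnn m); rewrite pm.
elim: a => [_|a IH am].
  have -> : p 0%N = k by apply/rowP => i; rewrite mxE.
  by rewrite subrr normr0 mul0r.
have step : `|u (dyadic n (p a.+1)) - u (dyadic n (p a))| <= r ^+ n.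
  have /andP[] := kl (Ordinal am); rewrite le_eqVlt => /orP[/eqP e _|lt le].
    have -> : p a.+1 = p a.
      apply/rowP => i; rewrite !mxE ltnS leq_eqVlt.
      case: eqP => //= ia; rewrite ia ltnn.
      by have -> : i = Ordinal am by exact/val_inj.
    by rewrite subrr normr0 exprn_ge0// ltW.
  have -> : p a.+1 = p a + delta_mx 0 (Ordinal am); last exact: un.
  apply/rowP => i; rewrite !mxE eqxx/= ltnS leq_eqVlt.
  case: (eqVneq i (Ordinal am)) => [->|ia] /=.
    rewrite eqxx ltnn/=; apply/eqP; rewrite eq_le le/=.
    by move: lt; rewrite -lezD1.
  have -> : (i == a :> nat) = false.
    by apply: contra_neqF ia => /eqP ia; exact/val_inj.
  by rewrite addr0.
rewrite -(subrKA (u (dyadic n (p a)))) (le_trans (ler_normD _ _))//.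
rewrite -natr1 mulrDl mul1r [leRHS]addrC.
by apply: lerD => //; exact/IH/ltnW.
Qed.

(** Walks only go up, so the two points are compared through their coordinatewise minimum. *)
Lemma small_increments_close u n k l : small_increments u n ->
  (forall i, k 0 i <= l 0 i + 1) -> (forall i, l 0 i <= k 0 i + 1) ->
  (forall i, `|k 0 i| <= 4 ^+ n) -> (forall i, `|l 0 i| <= 4 ^+ n) ->
  `|u (dyadic n k) - u (dyadic n l)| <= 2 * m%:R * r ^+ n.
Proof.
move=> un kl lk kn ln.
pose p : 'rV[int]_m := \row_i Num.min (k 0 i) (l 0 i).
have pn i : `|p 0 i| <= 4 ^+ n by rewrite mxE /Num.min; case: ifP.
have hk : `|u (dyadic n k) - u (dyadic n p)| <= m%:R * r ^+ n.
  apply: small_increments_walk => // i; rewrite mxE; have := kl i.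
  by case: (leP (k 0 i) (l 0 i)) => ? ?; apply/andP; split; lia.
have hl : `|u (dyadic n l) - u (dyadic n p)| <= m%:R * r ^+ n.
  apply: small_increments_walk => // i; rewrite mxE; have := lk i.
  by case: (leP (k 0 i) (l 0 i)) => ? ?; apply/andP; split; lia.
rewrite -(subrKA (u (dyadic n p))) (le_trans (ler_normD _ _))//.
rewrite [X in _ + X]distrC; lra.
Qed.

(** Refining the grid once moves each index by 0 or 1 finer step, so the approximations of a point
    have geometric increments, uniformly on bounded sets. Points closer than [2 ^- n] have
    neighbouring approximations at level [n], whence the continuity of the limit. *)
Lemma dyadic_chaining u n0 : (forall n, (n0 <= n)%N -> small_increments u n) ->
  (forall t, cvgn (fun n => u (dyadic n (dyadic_floor n t)))) /\
  continuous (fun t => limn (fun n => u (dyadic n (dyadic_floor n t)))).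
Proof.
move=> un.
pose ut t n := u (dyadic n (dyadic_floor n t)).
have r10 : 0 < 1 - r by case/andP: r01 => _; rewrite subr_gt0.
(* [c * r ^+ n] is the sum of the bounds [m%:R * r ^+ q] over the levels [q > n]. *)
pose c := m%:R * r / (1 - r).
have bd (M : R) : exists n1, forall n, (n1 <= n)%N ->
    small_increments u n /\ M + 1 <= 2 ^+ n.
  have [n1 h] : exists n1, M + 1 <= 2 ^+ n1.
    pose a := Num.bound (`|M| + 1); exists a.
    apply: (@le_trans _ _ a%:R).
      apply: (@le_trans _ _ (`|M| + 1)); first by rewrite lerD2r ler_norm.
      by apply/ltW/archi_boundP; rewrite addr_ge0.
    by rewrite -natrX ler_nat ltnW// ltn_expl.
  exists (maxn n0 n1) => n; rewrite geq_max => /andP[n0n n1n]; split; first exact: un.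
  by apply: (le_trans h); rewrite ler_eXn2l// ltr1n.
have main (M : R) : exists n1, forall n, (n1 <= n)%N ->
   [/\ small_increments u n, M + 1 <= 2 ^+ n &
    forall t, (forall i, `|t 0 i| <= M) ->
    cvgn (ut t) /\ `|limn (ut t) - ut t n| <= c * r ^+ n].
  have [n1 h1] := bd M; exists n1 => n n1n; have [h2 h3] := h1 n n1n.
  split => // t tM.
  have incr p : `|ut t (p.+1 + n)%N - ut t (p + n)%N| <= m%:R * r ^+ n.+1 * r ^+ p.
    have [_ hM] := h1 _ (leq_trans n1n (leq_addl p n)).
    have [hs hM'] := h1 _ (leq_trans n1n (leq_addl p.+1 n)).
    have -> : m%:R * r ^+ n.+1 * r ^+ p = m%:R * r ^+ (p.+1 + n).
      by rewrite -mulrA -exprD addSn -addnS addnC.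
    rewrite /ut [dyadic (p + n) _]dyadicS -addSn.
    apply: small_increments_walk => // i.
    - exact: dyadic_floor_step.
    - rewrite mxE normrM exprS ger0_norm// ler_pM//.
      exact: (dyadic_floor_bound (tM i) hM).
    - exact: (dyadic_floor_bound (tM i) hM').
  have [cv le] := geometric_increments_cvg r01 incr.
  have cvt : cvgn (ut t).
    have /cvg_ex[a ca] := cv; apply/cvg_ex; exists a.
    by rewrite -(cvg_shiftn n).
  split=> //; have := le 0%N; rewrite add0n expr0 mulr1.
  have -> : limn (fun p => ut t (p + n)%N) = limn (ut t).
    by apply/cvg_lim => //; rewrite cvg_shiftn.
  by move/le_trans; apply; rewrite /c exprS mulrA -!mulrA [r ^+ n / _]mulrC.
(* Two truncation errors of at most [c * r ^+ n], plus [2 * m%:R * r ^+ n] between neighbouring grid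
   points. *)
have [K cK] : exists K : R, K = 2 * c + 2 * m%:R by exists (2 * c + 2 * m%:R).
have bnd t : exists M : R, forall i, `|t 0 i| <= M.
  exists (\sum_i `|t 0 i|) => i.
  by rewrite (bigD1 i)//= lerDl sumr_ge0.
split=> [t|t].
  have [M tM] := bnd t; have [n1 h] := main M.
  by have [_ _ /(_ t tM)[]] := h n1 (leqnn n1).
have [M tM] := bnd t; have [n1 h] := main (M + 1).
have FF : Filter (nbhs t) by exact: nbhs_filter.
apply/cvgrPdist_lt => e e0.
have K0 : 0 <= K.
  by rewrite cK addr_ge0// mulr_ge0// divr_ge0 ?(ltW r10)// mulr_ge0 ?(ltW r0).
have [n n1n Kn] : exists2 n, (n1 <= n)%N & K * r ^+ n < e.
  have : (fun n => K * r ^+ n) @ \oo --> (0 : R).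
    rewrite -[0](mulr0 K); apply: cvgM; first exact: cvg_cst.
    by apply: cvg_expr; rewrite ger0_norm ?ltW//; case/andP: r01.
  move=> /cvgrPdist_lt/(_ e e0)[n2 _ hn2].
  exists (maxn n1 n2); first exact: leq_maxl.
  have /= := hn2 _ (leq_maxr n1 n2); rewrite sub0r normrN; exact/le_lt_trans/ler_norm.
have [hs hM ht] := h n n1n.
have n_gt0 : (0 : R) < 2 ^- n by rewrite invr_gt0 exprn_gt0.
have n_le1 : (2 : R) ^- n <= 1 by rewrite invf_le1 ?exprn_gt0// exprn_ege1// ler1n.
apply: filterS (nbhs_coord t n_gt0) => s ts.
have sM i : `|s 0 i| <= M + 1.
  rewrite -[s 0 i](subrK (t 0 i)) (le_trans (ler_normD _ _))// addrC lerD//.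
  by rewrite distrC (le_trans (ltW (ts i))).
have tM' i : `|t 0 i| <= M + 1 by rewrite (le_trans (tM i))// lerDl.
have [_ lt] := ht t tM'; have [_ ls] := ht s sM.
have := small_increments_close hs
  (fun i => dyadic_floor_near (ts i))
  (fun i => dyadic_floor_near (n := n) (s := t) (t := s) (i := i) _)
  (fun i => dyadic_floor_bound (sM i) hM)
  (fun i => dyadic_floor_bound (tM' i) hM).
rewrite -/(ut s n) -/(ut t n) => /(_ _)h3.
have h4 : `|ut s n - ut t n| <= 2 * m%:R * r ^+ n.
  by apply: h3 => i; rewrite distrC.
apply: le_lt_trans Kn.
rewrite -(subrKA (ut t n)) (le_trans (ler_normD _ _))//.
rewrite -(subrKA (ut s n) (ut t n)).
have h5 := ler_normD (ut t n - ut s n) (ut s n - limn (ut s)).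
rewrite distrC in ls; rewrite distrC in h4; rewrite cK; lra.
Qed.

End chaining.

Section geometric_series.
Context {R : realType}.

Lemma expr_small (r e : R) : 0 <= r < 1 -> 0 < e -> exists n, r ^+ n <= e.
Proof.
move=> /andP[r0 r1] e0.
have /cvgrPdist_le/(_ e e0)[n _ h] : GRing.exp r @ \oo --> (0 : R).
  by apply: cvg_expr; rewrite ger0_norm.
exists n; have /= := h n (leqnn n).
by rewrite sub0r normrN ger0_norm ?exprn_ge0.
Qed.

Lemma nneseries_geometric_lty (c r : R) : 0 <= c -> 0 <= r < 1 ->
  (\sum_(0 <= n <oo) (c * r ^+ n)%:E < +oo)%E.
Proof.
move=> c0 /andP[r0 r1].
have r10 : 0 < 1 - r by rewrite subr_gt0.
apply: (@le_lt_trans _ _ (c / (1 - r))%:E); last exact: ltry.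
apply: lime_le.
  by apply: is_cvg_nneseries => n _ _; rewrite lee_fin mulr_ge0 ?exprn_ge0.
apply: nearW => n /=; rewrite sumEFin lee_fin.
suff -> : \sum_(0 <= i < n) c * r ^+ i = c * (1 - r ^+ n) / (1 - r).
  rewrite ler_pM2r ?invr_gt0// ler_piMr// gerBl exprn_ge0//.
elim: n => [|n IH]; first by rewrite big_geq// expr0 subrr mulr0 mul0r.
by rewrite big_nat_recr//= IH exprS; field; rewrite gt_eqF.
Qed.

End geometric_series.

(** * Borel-Cantelli and the Kolmogorov continuity theorem *)

Section kolmogorov.
Context {R : realType} {d : measure_display} {T : measurableType d}.
Context {P : probability T R}.

Lemma probability_bigsetU_le (I : Type) (s : seq I) (A : I -> set T) (c : R) :
  (forall i, measurable (A i)) -> (forall i, (P (A i) <= c%:E)%E) ->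
  (P (\big[setU/set0]_(i <- s) A i) <= ((size s)%:R * c)%:E)%E.
Proof.
move=> mA Ac; elim: s => [|i s IH]; first by rewrite big_nil measure0 mul0r.
rewrite big_cons; apply: (le_trans (measureU2 _ _ _)) => //.
  exact: bigsetU_measurable.
by rewrite /= -natr1 mulrDl mul1r addrC EFinD leeD.
Qed.

Lemma exists_rv (f : T -> R) : measurable_fun setT f ->
  exists X : {RV P >-> R}, X = f :> (T -> R).
Proof.
move=> mf; pose mixin := isMeasurableFun.Build _ _ _ _ f mf.
by pose X : {mfun T >-> R} := HB.pack f mixin; exists X.
Qed.

Variables (m : nat) (U : 'rV[R]_m -> {RV P >-> R}) (C r : R).
Hypothesis r01 : 0 < r < 1.
Hypothesis U_gauss : forall n (k : 'rV[int]_m) i,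
  gaussian_rv P (fun w => U (dyadic n (k + delta_mx 0 i)) w - U (dyadic n k) w).
Hypothesis U_incr : forall n (k : 'rV[int]_m) i,
  ('E_P[fun w => ((U (dyadic n (k + delta_mx 0 i)) w -
                   U (dyadic n k) w) ^+ 2)%R] <= (C * (r ^+ 4) ^+ n)%:E)%E.

Let r0 : 0 < r. Proof. by case/andP: r01. Qed.

(* The boxes |k_i| <= 4^n exhaust R^m at scale 2^-n, so that a single
   Borel-Cantelli argument covers all bounded regions. *)
Let box n : finType := ({ffun 'I_m -> 'I_(2 * 4 ^ n).+1} * 'I_m)%type.
Let center n (x : box n) : 'rV[int]_m := \row_i ((x.1 i)%:Z - (4 ^ n)%:Z).

Let jump n (x : box n) : set T := [set w | r ^+ n <=
  `|U (dyadic n (center x + delta_mx 0 x.2)) w - U (dyadic n (center x)) w|].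

Let bad n : set T := \big[setU/set0]_(x <- enum {: box n}) jump x.

Let measurable_jump n (x : box n) : measurable (jump x).
Proof.
rewrite -[jump x]setTI; apply: measurable_fun_le => //.
by apply: measurableT_comp => //; exact: measurable_funB.
Qed.

Let measurable_bad n : measurable (bad n).
Proof. by apply: bigsetU_measurable => x _; exact: measurable_jump. Qed.

Let box_size n : (size (enum {: box n}) <= m * 3 ^ m * (4 ^ m) ^ n)%N.
Proof.
rewrite -cardE card_prod card_ffun !card_ord mulnC -mulnA leq_mul2l; apply/orP; right.
have -> : ((4 ^ m) ^ n = (4 ^ n) ^ m)%N by rewrite -!expnM mulnC.
have [->|m0] := posnP m; first by rewrite !expn0.
rewrite -expnMn leq_exp2r//.
by rewrite ltn_pmul2r// expn_gt0.
Qed.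

Let not_bad_small_increments n w : ~ bad n w ->
  small_increments r (fun t => U t w) n.
Proof.
move=> nb k i kn; rewrite leNgt; apply/negP => h; apply: nb.
have e4 : (4 ^ n)%:Z = 4 ^+ n by rewrite -natz natrX.
have kb (l : 'I_m) : (absz (k 0 l + (4 ^ n)%:Z)%R < (2 * 4 ^ n).+1)%N.
  by have := kn l; rewrite -e4; lia.
pose x : box n := ([ffun l => Ordinal (kb l)], i).
have cx : center x = k.
  apply/rowP => l; rewrite mxE ffunE /=.
  by have := kn l; rewrite -e4; lia.
rewrite /bad -bigcup_seq; exists x; first by rewrite /= mem_enum.
by rewrite /jump cx /=; exact: ltW.
Qed.

Let good := ~` lim_sup_set bad.

Let measurable_good : measurable good.
Proof.
apply: measurableC; apply: bigcap_measurable => // n _.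
by apply: bigcup_measurable => k _.
Qed.

(** At threshold [r ^+ n] and second moment of order [(r ^+ 4) ^+ n], the tail bound of order [q]
    gives each jump a probability of order [(r ^+ 2) ^+ (q * n)], against a number of cells of order
    [(4 ^ m) ^ n]. *)
Let lim_sup_bad0 : P (lim_sup_set bad) = 0%E.
Proof.
apply: lim_sup_set_cvg0 => //.
(* [C] has no sign, while the tail bound asks for a positive bound on the second moment. *)
pose c := `|C| + 1.
have c0 : 0 < c by rewrite ltr_wpDl.
have m4 : (0 : R) < 4 ^+ m by rewrite exprn_gt0.
(* This [q] makes the union bound at level [n] at most a constant times [2^-1 ^+ n]. *)
have [q hq] : exists q, (r ^+ 2) ^+ q <= 2^-1 / 4 ^+ m.
  apply: expr_small; last by rewrite divr_gt0// invr_gt0.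
  by rewrite exprn_ge0 ?(ltW r0)//= exprn_ilt1 ?(ltW r0)//; case/andP: r01.
pose K := (m * 3 ^ m)%:R * (tail_cst R q * c ^+ q).
have K0 : 0 <= K by rewrite mulr_ge0// mulr_ge0 ?exprn_ge0 ?(ltW c0)// ltW//
    tail_cst_gt0.
apply: (@le_lt_trans _ _ (\sum_(0 <= n <oo) (K * 2^-1 ^+ n)%:E)%E); last first.
  by apply: nneseries_geometric_lty => //; lra.
apply: lee_nneseries => n _ //.
have rn : 0 < r ^+ n by rewrite exprn_gt0.
have jumpP (x : box n) : (P (jump x) <= (tail_cst R q * c ^+ q * ((r ^+ 2) ^+
    q) ^+ n)%:E)%E.
  pose D : {RV P >-> R} := (U (dyadic n (center x + delta_mx 0 x.2)) \- U
      (dyadic n (center x)))%R.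
  have := @gaussian_tail _ _ _ _ D (c * (r ^+ 4) ^+ n) (r ^+ n) q (U_gauss _ _ _).
  rewrite mulr_gt0 ?exprn_gt0// => /(_ _ isT isT); move/(_ _)/le_trans; apply.
    apply: (le_trans (U_incr _ _ _)).
    rewrite lee_fin ler_pM2r ?exprn_gt0//.
    by rewrite (le_trans (ler_norm _))// lerDl.
  rewrite lee_fin -mulrA ler_pM2l ?tail_cst_gt0//.
  suff -> : c * r ^+ 4 ^+ n / r ^+ n ^+ 2 = c * (r ^+ 2) ^+ n.
    by rewrite exprMn (exprAC (r ^+ 2) n q).
  have -> : (r ^+ 4) ^+ n = (r ^+ 2) ^+ n * (r ^+ n) ^+ 2.
    by rewrite -!exprM -exprD; congr (_ ^+ _); lia.
  by rewrite mulrA mulfK// expf_neq0// gt_eqF.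
apply: (le_trans (probability_bigsetU_le _ (@measurable_jump n) jumpP)).
rewrite lee_fin.
apply: (@le_trans _ _ ((m * 3 ^ m * (4 ^ m) ^ n)%:R * (tail_cst R q * c ^+ q *
    r ^+ 2 ^+ q ^+ n))).
  rewrite ler_wpM2r ?ler_nat// mulr_ge0 ?exprn_ge0 ?(ltW r0)// mulr_ge0
      ?exprn_ge0 ?(ltW c0)//.
  by rewrite ltW// tail_cst_gt0.
rewrite natrM mulrACA -/K ler_wpM2l//.
rewrite natrX -exprMn lerXn2r ?nnegrE ?mulr_ge0 ?exprn_ge0 ?(ltW r0)//.
by rewrite natrX mulrC -ler_pdivlMr.
Qed.

Let approx n (t : 'rV[R]_m) w := U (dyadic n (dyadic_floor n t)) w.

Let good_chaining w : good w ->
  (forall t, cvgn (fun n => approx n t w)) /\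
  continuous (fun t => limn (fun n => approx n t w)).
Proof.
move=> gw.
have [n0 h] : exists n0, forall n, (n0 <= n)%N -> ~ bad n w.
  apply: contrapT => nex; apply: gw => n _; apply: contrapT => nb; apply: nex.
  by exists n => p np bp; apply: nb; exists p.
apply: (dyadic_chaining r01 (u := fun t => U t w) (n0 := n0)) => n n0n.
exact/not_bad_small_increments/h.
Qed.

(** Only the grid values of [U] are controlled, so [V] is described as a limit along the grid, with
    one null set for all [t]; agreement with [U] elsewhere is left to each application. This allows
    [U] to be meaningless at some points off the grid. *)
Theorem kolmogorov_continuity :
  exists V : 'rV[R]_m -> {RV P >-> R},
    (forall w, continuous (sample_path V w)) /\
    {ae P, forall w, forall t,
       U (dyadic n (dyadic_floor n t)) w @[n --> \oo] --> V t w}.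
Proof.
(* The value 0 off [good] makes every path continuous, not only almost every one. *)
pose v t (w : T) : R := if w \in good then limn (fun n => approx n t w) else 0.
have mv t : measurable_fun setT (v t).
  apply: (@measurable_fun_cvg _ _ _ _ (fun n w => \1_good w * approx n t w)).
    by move=> n; apply: measurable_funM => //; exact: measurable_indic.
  move=> w _; rewrite /v indicE; case: ifPn => [/set_mem gw|_] /=.
    under eq_fun do rewrite mul1r.
    by have [/(_ t)] := good_chaining gw.
  by under eq_fun do rewrite mul0r; exact: cvg_cst.
have /choice[V VE] t := exists_rv (mv t).
exists V; split=> [w|].
  have -> : sample_path V w = fun t => v t w by apply/funext => t; rewrite
      /sample_path VE.
  rewrite /v; have [gw|_] := boolP (w \in good).
    by have [] := good_chaining (set_mem gw).
  by move=> t; have FF : Filter (nbhs t) := nbhs_filter t; exact: cvg_cst.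
exists (lim_sup_set bad); split=> //.
  by rewrite -[X in measurable X]setCK; exact: measurableC.
move=> w /= nw; apply: contrapT => gw; apply: nw => t.
rewrite VE /v mem_set//.
by have [/(_ t)] := good_chaining gw.
Qed.

End kolmogorov.

(** * Increments of the complex exponential *)

Section exponential_increments.
Context {R : realType}.
Implicit Types (x y h k : R) (z : R[i]).

Definition sqn z : R := complex.Re z ^+ 2 + complex.Im z ^+ 2.

Lemma sqn_ge0 z : 0 <= sqn z.
Proof. by rewrite addr_ge0 ?sqr_ge0. Qed.

Lemma sqnM z z' : sqn (z * z') = sqn z * sqn z'.
Proof. by case: z => a b; case: z' => a' b'; rewrite /sqn /=; ring. Qed.

Lemma sqnN z : sqn (- z) = sqn z.
Proof. by case: z => a b; rewrite /sqn /= !sqrrN. Qed.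

Lemma sqnD_le z z' : sqn (z + z') <= 2 * sqn z + 2 * sqn z'.
Proof.
case: z => a b; case: z' => a' b'; rewrite /sqn /=.
have := sqr_ge0 (a - a'); have := sqr_ge0 (b - b'); lra.
Qed.

Lemma sqnB_le z z' : sqn (z - z') <= 2 * sqn z + 2 * sqn z'.
Proof. by rewrite -(sqnN z') sqnD_le. Qed.

Lemma sqn_real x : sqn (real_complex R x) = x ^+ 2.
Proof. by rewrite /sqn /= expr0n addr0. Qed.

Lemma sqn_expi x : sqn (expi x) = 1.
Proof. exact: cos2Dsin2. Qed.

Lemma expiD x y : expi (x + y) = expi x * expi y.
Proof. by rewrite /expi cosD sinD; congr Complex; ring. Qed.

Lemma mean_value_le (f df : R -> R) x (K : R) :
  (forall y, is_derive y 1 f (df y)) ->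
  (forall y, `|y| <= `|x| -> `|df y| <= K) -> `|f x - f 0| <= K * `|x|.
Proof.
move=> fd dfK.
have cf (A : set R) : {within A, continuous f}.
  apply: continuous_subspaceT => y.
  by apply/differentiable_continuous/derivable1_diffP; case: (fd y).
have [x0|x0] := leP 0 x.
  have [c] := MVT_segment x0 (fun y _ => fd y) (cf _).
  rewrite in_itv/= => /andP[c0 cx] ->.
  rewrite subr0 normrM ler_wpM2r// dfK// !ger0_norm//.
have [c] := MVT_segment (ltW x0) (fun y _ => fd y) (cf _).
rewrite in_itv/= => /andP[c0 cx] e.
by rewrite distrC e sub0r normrM normrN ler_wpM2r// dfK// !ler0_norm ?lerN2// ltW.
Qed.

Lemma sin_le_norm x : `|sin x| <= `|x|.
Proof.
have := @mean_value_le sin cos x 1 (fun y => is_derive_sin y) (fun y _ => cos_max y).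
by rewrite sin0 subr0 mul1r.
Qed.

Lemma one_sub_cos x : 1 - cos x = 2 * sin (x / 2) ^+ 2.
Proof.
rewrite {1}(splitr x) cosD -!expr2.
by have := cos2Dsin2 (x / 2); lra.
Qed.

Lemma one_sub_cos_le x : 1 - cos x <= x ^+ 2 / 2.
Proof.
rewrite one_sub_cos.
have : sin (x / 2) ^+ 2 <= (x / 2) ^+ 2.
  by rewrite -(real_normK (num_real (sin _))) -(real_normK (num_real (x / 2)))
      lerXn2r ?nnegrE ?sin_le_norm.
lra.
Qed.

Lemma sqn_expiB1E x : sqn (expi x - 1) = 2 * (1 - cos x).
Proof. by rewrite /sqn /= subr0; have := cos2Dsin2 x; lra. Qed.

Lemma sqn_expiB1_le x : sqn (expi x - 1) <= x ^+ 2.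
Proof. by rewrite sqn_expiB1E; have := one_sub_cos_le x; lra. Qed.

Lemma sqn_expiB1_le4 x : sqn (expi x - 1) <= 4.
Proof. by rewrite sqn_expiB1E; have := cos_geN1 x; lra. Qed.

(** The derivative [cos y - 1] is the real part of [expi y - 1], hence at most [|y|] in modulus;
    this gives a quadratic bound, which suffices for the remainder below. *)
Lemma sin_sub_id_le x : `|sin x - x| <= x ^+ 2.
Proof.
have dsin y : is_derive y 1 (fun x : R => sin x - x) (cos y - 1).
  by apply: is_deriveB.
have := @mean_value_le _ _ x `|x| dsin; rewrite sin0 !subr0 -expr2 real_normK
    ?num_real//; apply.
move=> y yx; apply: le_trans yx.
rewrite -ler_sqr ?nnegrE// !real_normK ?num_real//.
apply: le_trans (sqn_expiB1_le y).
by rewrite /sqn /= subr0 lerDl sqr_ge0.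
Qed.

Lemma sqn_expi_remainder x : sqn (expi x - 1 - Complex 0 x) <= 2 * x ^+ 4.
Proof.
rewrite /sqn /= !subr0.
have c1 : (cos x - 1) ^+ 2 <= (x ^+ 2) ^+ 2.
  have := one_sub_cos_le x; have := cos_le1 x; have := sqr_ge0 x => h1 h2 h3.
  rewrite -[leLHS]sqrrN lerXn2r ?nnegrE; lra.
have s1 : (sin x - x) ^+ 2 <= (x ^+ 2) ^+ 2.
  rewrite -[leLHS]real_normK ?num_real// lerXn2r ?nnegrE ?sqr_ge0//.
  exact: sin_sub_id_le.
rewrite -exprM in c1 s1; lra.
Qed.

(** With [c = k - h], the terms of first order in [x] cancel; identity [E] leaves two Taylor
    remainders and a product of small factors, each of order [c * h * x ^+ 2] times [h] or [c].
    Since [|h| <= |k|], both [h] and [c] are controlled by [k]. *)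
Lemma sqn_difference_quotient_aux x h k : h ^+ 2 <= k ^+ 2 ->
  sqn (real_complex R k * (expi (h * x) - 1) - real_complex R h * (expi (k * x) - 1))
  <= 42 * x ^+ 4 * (h - k) ^+ 2 * (h ^+ 2 * k ^+ 2).
Proof.
move=> hk; pose c := k - h.
pose rh := expi (h * x) - 1 - Complex 0 (h * x).
pose rc := expi (c * x) - 1 - Complex 0 (c * x).
have E : real_complex R k * (expi (h * x) - 1) - real_complex R h * (expi (k * x) - 1)
    = real_complex R c * rh - real_complex R h * (expi (h * x) * rc)
      - Complex 0 (c * h * x) * (expi (h * x) - 1).
  have -> : expi (k * x) = expi (h * x) * expi (c * x) by rewrite -expiD /c;
      congr expi; ring.
  have -> : real_complex R k = real_complex R h + real_complex R c.
    by rewrite -rmorphD /c subrKC.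
  have eh : Complex 0 (c * h * x) = real_complex R c * Complex 0 (h * x).
    by apply/eqP; rewrite eq_complex /=; apply/andP; split; apply/eqP; ring.
  have ec : real_complex R c * Complex 0 (h * x) = real_complex R h * Complex 0 (c * x).
    by apply/eqP; rewrite eq_complex /=; apply/andP; split; apply/eqP; ring.
  have -> : real_complex R h * (expi (h * x) * rc) =
      expi (h * x) * (real_complex R h * (expi (c * x) - 1)) -
      expi (h * x) * (real_complex R c * Complex 0 (h * x)).
    by rewrite ec /rc; ring.
  by rewrite eh /rh; ring.
rewrite E.
apply: (le_trans (sqnB_le _ _)).
have h1 := sqnB_le (real_complex R c * rh) (real_complex R h * (expi (h * x) * rc)).
have h2 : sqn (real_complex R c * rh) <= c ^+ 2 * (2 * (h * x) ^+ 4).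
  by rewrite sqnM sqn_real ler_wpM2l ?sqr_ge0// sqn_expi_remainder.
have h3 : sqn (real_complex R h * (expi (h * x) * rc)) <= h ^+ 2 * (2 * (c * x) ^+ 4).
  by rewrite !sqnM sqn_expi sqn_real mul1r ler_wpM2l ?sqr_ge0// sqn_expi_remainder.
have h4 : sqn (Complex 0 (c * h * x) * (expi (h * x) - 1)) <= (c * h * x) ^+ 2
    * (h * x) ^+ 2.
  rewrite sqnM {1}/sqn /= expr0n add0r ler_wpM2l ?sqr_ge0//.
  exact: sqn_expiB1_le.
have ck : c ^+ 2 <= 4 * k ^+ 2.
  by rewrite /c; have := sqr_ge0 (k + h); lra.
pose q := x ^+ 4 * c ^+ 2 * h ^+ 2.
have x4 : 0 <= x ^+ 4 by rewrite exprn_even_ge0.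
have q0 : 0 <= q := mulr_ge0 (mulr_ge0 x4 (sqr_ge0 _)) (sqr_ge0 _).
have qh : q * h ^+ 2 <= q * k ^+ 2 by rewrite ler_wpM2l.
have qc : q * c ^+ 2 <= q * (4 * k ^+ 2) by rewrite ler_wpM2l.
have -> : (h - k) ^+ 2 = c ^+ 2 by rewrite -sqrrN opprB.
have e2 : c ^+ 2 * (2 * (h * x) ^+ 4) = 2 * (q * h ^+ 2) by rewrite /q; ring.
have e3 : h ^+ 2 * (2 * (c * x) ^+ 4) = 2 * (q * c ^+ 2) by rewrite /q; ring.
have e4 : (c * h * x) ^+ 2 * (h * x) ^+ 2 = q * h ^+ 2 by rewrite /q; ring.
(* 42 = 4 * 2 + 4 * 8 + 2: two uses of [sqnB_le] weight the three terms by 4, 4 and 2, and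
   [c ^+ 2 <= 4 * k ^+ 2] turns the bound [2 * (q * c ^+ 2)] of the middle one into
   [8 * (q * k ^+ 2)]. *)
have -> : 42 * x ^+ 4 * c ^+ 2 * (h ^+ 2 * k ^+ 2) = 42 * (q * k ^+ 2) by
    rewrite /q; ring.
rewrite e2 in h2; rewrite e3 in h3; rewrite e4 in h4; lra.
Qed.

(** The Lipschitz constant in the step does not degenerate near 0, because dividing by
    [h ^+ 2 * k ^+ 2] removes exactly the last factor of the preceding bound. Its hypothesis is met
    after exchanging [h] and [k] if necessary. *)
Lemma sqn_difference_quotient x h k : h != 0 -> k != 0 ->
  sqn (real_complex R h^-1 * (expi (h * x) - 1) -
       real_complex R k^-1 * (expi (k * x) - 1)) <= 42 * x ^+ 4 * (h - k) ^+ 2.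
Proof.
wlog hk : h k / h ^+ 2 <= k ^+ 2 => [hw h0 k0|h0 k0].
  have [|/ltW hk] := leP (h ^+ 2) (k ^+ 2); first by move/hw; exact.
  by rewrite -sqnN opprB -(sqrrN (h - k)) opprB; exact: hw.
have := sqn_difference_quotient_aux x hk.
rewrite -ler_pdivrMr; last by rewrite mulr_gt0// exprn_even_gt0.
move/(le_trans _); apply; rewrite le_eqVlt; apply/orP; left; apply/eqP.
have -> : real_complex R h^-1 * (expi (h * x) - 1) - real_complex R k^-1 *
    (expi (k * x) - 1)
  = real_complex R (h * k)^-1 * (real_complex R k * (expi (h * x) - 1) -
      real_complex R h * (expi (k * x) - 1)).
  have -> : real_complex R h^-1 = real_complex R (h * k)^-1 * real_complex R k.
    by rewrite -rmorphM; congr (real_complex R _); field; rewrite h0 k0.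
  have -> : real_complex R k^-1 = real_complex R (h * k)^-1 * real_complex R h.
    by rewrite -rmorphM; congr (real_complex R _); field; rewrite h0 k0.
  by ring.
rewrite sqnM sqn_real mulrC exprVn exprMn; congr (_ / _).
Qed.

Lemma sqn_quotient_le x h : h != 0 ->
  sqn (real_complex R h^-1 * (expi (h * x) - 1)) <= x ^+ 2.
Proof.
move=> h0; rewrite sqnM sqn_real exprVn mulrC ler_pdivrMr ?exprn_even_gt0//.
by rewrite -exprMn [x * h]mulrC sqn_expiB1_le.
Qed.

End exponential_increments.

(** * Anisotropic integrals *)

Section anisotropic.
Context {R : realType} {N : nat}.
Variables (beta : 'I_N -> R).
Implicit Types l : 'rV[R]_N.
Hypothesis beta_gt0 : forall j, 0 < beta j.

Definition aniso (l : 'rV[R]_N) : R := \sum_(j < N) `|l 0 j| `^ beta j.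

Local Notation Q := (\sum_(j < N) (beta j)^-1).

Lemma aniso_ge0 l : 0 <= aniso l.
Proof. by apply: sumr_ge0 => j _; exact: powR_ge0. Qed.

Lemma coord_le_aniso l j : `|l 0 j| `^ beta j <= aniso l.
Proof.
by rewrite /aniso (bigD1 j)//= lerDl sumr_ge0// => i _; exact: powR_ge0.
Qed.

(** A frequency coordinate weighs as much as [aniso] to the power [1 / beta j]; with [a = 2] this
    converts the factor [l 0 j ^+ 2] of a divided difference into the exponent [2 / beta j]. *)
Lemma coord_powR_le_aniso l j (a : R) : 0 <= a ->
  `|l 0 j| `^ a <= aniso l `^ (a / beta j).
Proof.
move=> a0.
have -> : `|l 0 j| `^ a = (`|l 0 j| `^ beta j) `^ (a / beta j).
  by rewrite -powRrM mulrCA divff ?gt_eqF// mulr1.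
apply: ge0_ler_powR; rewrite ?nnegrE ?powR_ge0 ?aniso_ge0//.
  by rewrite divr_ge0// ltW.
exact: coord_le_aniso.
Qed.

Lemma measurable_coord (j : 'I_N) :
  measurable_fun setT (fun x : N.-tuple R => row_of_tuple x 0 j).
Proof.
rewrite (_ : (fun _ => _) = fun x => tnth x j); last first.
  by apply/funext => x; rewrite mxE.
exact: measurable_tnth.
Qed.

Lemma measurable_aniso :
  measurable_fun setT (fun x : N.-tuple R => aniso (row_of_tuple x)).
Proof.
apply: measurable_sum => j.
apply: (measurableT_comp (measurable_powR (beta j))).
by apply: measurableT_comp => //; exact: measurable_coord.
Qed.

Lemma lebesgue_tuple_sym_box (a : 'I_N -> R) : (forall j, 0 < a j) ->
  measurable [set x : N.-tuple R | forall j, `|tnth x j| <= a j] /\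
  lebesgue_tuple R N [set x | forall j, `|tnth x j| <= a j] =
    (\prod_(j < N) (2 * a j))%:E.
Proof.
move=> a0; pose A j : set R := `[- a j, a j]%classic.
have AE : [set x : N.-tuple R | forall j, `|tnth x j| <= a j] =
          [set x | forall j, A j (tnth x j)].
  by apply/seteqP; split => x /= h j; have := h j; rewrite /A /= in_itv/= ler_norml.
have mA j : measurable (A j) by exact: measurable_itv.
rewrite AE; split.
  rewrite (_ : [set x | _] = \bigcap_(i in setT)
      ((fun x : N.-tuple R => tnth x i) @^-1` A i)).
    apply: fin_bigcap_measurable => // i _.
    by rewrite -[X in measurable X]setTI; exact: measurable_tnth.
  by apply/seteqP; split => x /= h i; [move=> _|]; exact: h.
rewrite lebesgue_tuple_box// -prodEFin; apply: eq_bigr => j _.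
rewrite /A lebesgue_measure_itv/= lte_fin -EFinD ifT; last by have := a0 j; lra.
by congr (_%:E); ring.
Qed.

Lemma prod_powR (a : R) (e : 'I_N -> R) : 0 < a ->
  \prod_(j < N) (a `^ e j) = a `^ (\sum_(j < N) e j).
Proof.
move=> a0; elim/big_rec2: _ => [|j x y _ ->]; first by rewrite powRr0.
by rewrite powRD// (gt_eqF a0) implybT.
Qed.

Lemma dyadic_shell (a b : R) : 0 < a -> a <= b ->
  exists k, a * 2 ^+ k <= b < a * 2 ^+ k.+1.
Proof.
move=> a0 ab.
have ex : exists k, b < a * 2 ^+ k.+1.
  pose n := Num.bound (b / a); exists n.
  rewrite mulrC -ltr_pdivrMr//.
  apply: (@lt_le_trans _ _ n%:R).
    by apply: archi_boundP; rewrite divr_ge0 ?(ltW a0)// (le_trans (ltW a0)).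
  rewrite -natrX ler_nat; apply: ltnW; rewrite expnS.
  by rewrite mul2n -addnn ltn_addl// ltn_expl.
have [k bk kmin] := ex_minnP ex; exists k; rewrite bk andbT.
case: k kmin {bk} => [_|k kmin]; first by rewrite expr0 mulr1.
by rewrite leNgt; apply/negP => /kmin; rewrite ltnn.
Qed.

(* The shell rho0 2^k <= aniso < rho0 2^(k+1) lies in a box of volume
   proportional to 2^(kQ). *)
Lemma aniso_integral_lty (kappa rho0 : R) : Q < kappa -> 0 < rho0 ->
  (\int[lebesgue_tuple R N]_(x in [set x | (rho0 <= aniso (row_of_tuple x))%R])
     (aniso (row_of_tuple x) `^ (- kappa))%:E < +oo)%E.
Proof.
move=> Qk rho00.
set D := [set x | _].
have mD : measurable D.
  by rewrite -[D]setTI; apply: measurable_fun_le => //; exact: measurable_aniso.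
have Q0 : 0 <= Q by apply: sumr_ge0 => j _; rewrite invr_ge0 ltW.
pose s k : R := rho0 * 2 ^+ k.
have s0 k : 0 < s k by rewrite mulr_gt0// exprn_gt0.
pose B k := [set x : N.-tuple R | forall j, `|tnth x j| <= s k.+1 `^ (beta j)^-1].
have BP k := @lebesgue_tuple_sym_box (fun j => s k.+1 `^ (beta j)^-1)
  (fun j => powR_gt0 _ (s0 _)).
have mB k : measurable (B k) by have [] := BP k.
have mf : measurable_fun setT
    (fun x : N.-tuple R => (aniso (row_of_tuple x) `^ (- kappa))%:E).
  apply/measurable_EFinP; apply: (measurableT_comp (measurable_powR (- kappa))).
  exact: measurable_aniso.
(* [g k] dominates the integrand on the [k]-th shell, where [aniso] is at least [s k]; taking whole
   boxes instead of shells only enlarges the sum. *)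
pose g k (x : N.-tuple R) : \bar R := (s k `^ (- kappa) * \1_(B k) x)%:E.
have g0 k x : (0 <= g k x)%E by rewrite lee_fin mulr_ge0 ?powR_ge0.
have mg k : measurable_fun setT (g k).
  by apply/measurable_EFinP/measurable_funM => //; exact: measurable_indic.
have s2 k (a : R) : s k `^ a = rho0 `^ a * (2 `^ a) ^+ k.
  rewrite /s powRM ?(ltW rho00) ?exprn_ge0//; congr (_ * _).
  rewrite -(powR_mulrn k (ler0n R 2)) -(powR_mulrn k (powR_ge0 2 a)).
  by rewrite -!powRrM mulrC.
apply: (@le_lt_trans _ _ (\int[lebesgue_tuple R N]_(x in D) (\sum_(0 <= k <oo)
    g k x))%E).
  apply: ge0_le_integral => //=.
  - by move=> x _; rewrite lee_fin powR_ge0.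
  - exact: measurable_funTS.
  - by apply: measurable_funTS; apply: ge0_emeasurable_sum.
  - move=> x Dx; have [k /andP[k1 k2]] := dyadic_shell rho00 Dx.
    apply: (le_trans _ (@nneseries_lim_ge _ (g ^~ x) xpredT 0 k.+1 (fun n _ _
        => g0 n x))).
    rewrite big_nat_recr//=.
    apply: (@le_trans _ _ (g k x)); last first.
      by rewrite leeDr// sume_ge0// => i _; exact: g0.
    rewrite /g indicE mem_set/= ?mulr1.
      rewrite lee_fin !powRN lef_pV2 ?posrE ?powR_gt0//; last exact:
          lt_le_trans (s0 k) k1.
      apply: ge0_ler_powR; rewrite ?nnegrE ?aniso_ge0 ?(ltW (s0 k))//.
      exact/ltW/(le_lt_trans Q0).
    move=> j; have := @coord_powR_le_aniso (row_of_tuple x) j 1 ler01.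
    rewrite powRr1// mxE div1r => h; apply: (le_trans h).
    apply: ge0_ler_powR; rewrite ?nnegrE ?aniso_ge0 ?(ltW (s0 _))//.
      by rewrite invr_ge0 ltW.
    exact: ltW.
apply: (@le_lt_trans _ _ (\int[lebesgue_tuple R N]_x (\sum_(0 <= k <oo) g k x))%E).
  apply: ge0_subset_integral => //; first exact: ge0_emeasurable_sum.
  by move=> x _; exact: nneseries_ge0.
rewrite integral_nneseries//.
(* The box [B k] has volume 2^N s_(k+1)^Q; the resulting geometric ratio 2^(Q - kappa) is below 1
   because [Q < kappa]. *)
pose c := rho0 `^ (- kappa) * (2 ^+ N * (2 * rho0) `^ Q).
have gE k : (\int[lebesgue_tuple R N]_x g k x = (c * (2 `^ (Q - kappa)) ^+ k)%:E)%E.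
  rewrite /g; under eq_integral do rewrite EFinM.
  rewrite ge0_integralZl//; last first.
  - by rewrite lee_fin powR_ge0.
  - exact/measurable_EFinP/measurable_indic.
  have -> : (\int[lebesgue_tuple R N]_x (\1_(B k) x)%:E = lebesgue_tuple R N (B k))%E.
    by rewrite integral_indic// setIT.
  have [_ ->] := BP k; rewrite -EFinM; congr (_%:E).
  rewrite big_split/= prodr_const card_ord (prod_powR _ (s0 _)) !s2 exprS.
  rewrite /c powRM ?(ltW rho00)// powRD; last by rewrite pnatr_eq0 implybT.
  rewrite exprMn; ring.
under eq_eseriesr do rewrite gE.
apply: nneseries_geometric_lty.
  by rewrite /c !mulr_ge0 ?powR_ge0 ?exprn_ge0.
rewrite powR_ge0/=.
rewrite -[ltRHS](powRr0 2) /powR pnatr_eq0/=.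
rewrite ltr_expR ltr_pM2r ?ln_gt0 ?ltr1n//; lra.
Qed.

End anisotropic.

Section euclidean.
Context {R : realType} {N : nat}.
Implicit Types l t : 'rV[R]_N.

Lemma dotp_ge0 l : 0 <= dotp l l.
Proof. by apply: sumr_ge0 => j _; rewrite -expr2 sqr_ge0. Qed.

Lemma eucl_sqr l : eucl l ^+ 2 = dotp l l.
Proof. by rewrite /eucl sqr_sqrtr// dotp_ge0. Qed.

Lemma coord_sqr_le_dotp l j : l 0 j ^+ 2 <= dotp l l.
Proof.
rewrite /dotp (bigD1 j)//= -expr2 lerDl sumr_ge0// => i _.
by rewrite -expr2 sqr_ge0.
Qed.

Lemma eucl_le_dotp (c : R) l : 0 <= c -> (c <= eucl l) = (c ^+ 2 <= dotp l l).
Proof. by move=> c0; rewrite -eucl_sqr ler_sqr ?nnegrE// sqrtr_ge0. Qed.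

Lemma measurable_dotp t :
  measurable_fun setT (fun x : N.-tuple R => dotp t (row_of_tuple x)).
Proof.
apply: measurable_sum => j; apply: measurable_funM => //.
exact: measurable_coord.
Qed.

Lemma measurable_dotpp :
  measurable_fun setT (fun x : N.-tuple R => dotp (row_of_tuple x) (row_of_tuple x)).
Proof.
by apply: measurable_sum => j; apply: measurable_funM; exact: measurable_coord.
Qed.

Lemma measurable_spectral_weight :
  measurable_fun setT (fun x : N.-tuple R =>
    eucl (row_of_tuple x) ^+ 2 / (1 + eucl (row_of_tuple x) ^+ 2)).
Proof.
rewrite (_ : (fun _ => _) = fun x : N.-tuple R =>
    let e := dotp (row_of_tuple x) (row_of_tuple x) in e * (1 + e) `^ (-1)).
  apply: measurable_funM; first exact: measurable_dotpp.
  apply: (measurableT_comp (measurable_powR (-1))).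
  by apply: measurable_funD => //; exact: measurable_dotpp.
apply/funext => x /=; rewrite eucl_sqr powR_inv1//.
by rewrite addr_ge0// dotp_ge0.
Qed.

End euclidean.

Section integral_bounds.
Context {R : realType} {d : measure_display} {T : measurableType d}.
Variable mu : {measure set T -> \bar R}.

Lemma integral_le_dominated (g G : T -> R) (c : R) :
  measurable_fun setT g -> measurable_fun setT G ->
  (forall x, 0 <= g x <= c * G x) -> (forall x, 0 <= G x) -> 0 <= c ->
  (\int[mu]_x (G x)%:E < +oo)%E ->
  (\int[mu]_x (g x)%:E <= (fine (\int[mu]_x (G x)%:E)%E * c)%:E)%E.
Proof.
move=> mg mG gG G0 c0 Goo.
have GE : (\int[mu]_x (G x)%:E)%E \is a fin_num.
  by rewrite ge0_fin_numE// integral_ge0// => x _; rewrite lee_fin.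
have -> : ((fine (\int[mu]_x (G x)%:E) * c)%:E = \int[mu]_x (c%:E * (G x)%:E))%E.
  rewrite mulrC EFinM fineK// ge0_integralZl ?lee_fin//.
    exact/measurable_EFinP.
  by move=> x _; rewrite lee_fin.
apply: ge0_le_integral => //.
- by move=> x _; rewrite lee_fin; case/andP: (gG x).
- exact/measurable_EFinP.
- by apply/measurable_EFinP; exact: measurable_funM.
- by move=> x _; rewrite -EFinM lee_fin; case/andP: (gG x).
Qed.

End integral_bounds.

(** * Decay of spectral integrals along dyadic scales *)

Section spectral_increment.
Context {R : realType} {N : nat}.
Variables (beta : 'I_N -> R) (gamma c2 c3 : R) (f : 'rV[R]_N -> R).
Hypothesis beta_gt0 : forall j, 0 < beta j.
Hypotheses (c2_gt0 : 0 < c2) (c3_gt0 : 0 < c3).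
Hypothesis f_ge0 : forall l, 0 <= f l.
Hypothesis mf : measurable_fun setT (fun x : N.-tuple R => f (row_of_tuple x)).
Hypothesis f_int : (\int[lebesgue_tuple R N]_x
  (eucl (row_of_tuple x) ^+ 2 / (1 + eucl (row_of_tuple x) ^+ 2) *
   f (row_of_tuple x))%:E < +oo)%E.
Hypothesis f_ub : forall l : 'rV[R]_N, c3 <= eucl l ->
  f l <= c2 / aniso beta l `^ gamma.

Local Notation Q := (\sum_(j < N) (beta j)^-1).

Lemma aniso_lower_bound : exists2 a : R, 0 < a <= 1 &
  forall l : 'rV[R]_N, c3 <= eucl l -> a <= aniso beta l.
Proof.
(* Were all coordinates below [b], the squared length would be at most [N%:R * b ^+ 2], which is
   less than [c3 ^+ 2]. *)
pose b := c3 / N.+1%:R.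
have b0 : 0 < b by rewrite divr_gt0.
(* A single number at least 1 and at least every inverse, so that [S^-1] is at most 1 and at most
   every power of [b] by [beta j]. *)
pose S := 1 + \sum_(j < N) (b `^ beta j)^-1.
have S1 : 1 <= S by rewrite lerDl sumr_ge0// => j _; rewrite invr_ge0 powR_ge0.
have S0 : 0 < S by apply: lt_le_trans S1.
exists S^-1; first by rewrite invr_gt0 S0 invf_le1.
move=> l; rewrite eucl_le_dotp ?(ltW c3_gt0)// => c3l.
have [j bj] : exists j, b <= `|l 0 j|.
  apply: contrapT => nb; move: c3l; apply/negP; rewrite -ltNge.
  have lb j : l 0 j * l 0 j <= b ^+ 2.
    rewrite -expr2 -real_normK ?num_real// lerXn2r ?nnegrE ?(ltW b0)// leNgt.
    by apply/negP => /ltW bl; apply: nb; exists j.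
  have : dotp l l <= N%:R * b ^+ 2.
    by rewrite mulr_natl -[X in _ *+ X]card_ord -sumr_const; exact: ler_sum.
  move/le_lt_trans; apply.
  have -> : c3 ^+ 2 = (N.+1%:R * N.+1%:R) * b ^+ 2 by rewrite /b; field.
  rewrite ltr_pM2r ?exprn_gt0// -natrM ltr_nat.
  by rewrite mulnS addSn ltnS leq_addr.
apply: le_trans (coord_le_aniso _ _ j).
apply: (@le_trans _ _ (b `^ beta j)).
  rewrite -[leRHS]invrK lef_pV2 ?posrE ?invr_gt0 ?powR_gt0//.
  rewrite /S (bigD1 j)//= addrCA lerDl addr_ge0// sumr_ge0// => i _.
  by rewrite invr_ge0 powR_ge0.
by apply: ge0_ler_powR; rewrite ?nnegrE ?(ltW b0)// ltW.
Qed.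

Variables (w : 'rV[R]_N -> R) (theta : R).
Hypothesis w_ge0 : forall l, 0 <= w l.
Hypothesis mw : measurable_fun setT (fun x : N.-tuple R => w (row_of_tuple x)).
Hypothesis w_le : forall l, w l <= 1 + dotp l l.
Hypothesis w_aniso : forall l, c3 <= eucl l -> w l <= aniso beta l `^ theta.
Hypothesis theta_lt : theta < gamma - Q.

Lemma min1_le_powR (y e : R) : 0 <= y -> 0 < e <= 1 -> Num.min 1 y <= y `^ e.
Proof.
move=> y0 /andP[e0 e1]; have [y1|y1] := leP 1 y.
  by rewrite -[leLHS](powRr0 y) ler_powR// ltW.
move: y0; rewrite le_eqVlt => /orP[/eqP <-|y0]; first exact: powR_ge0.
by apply: ger1_powR => //; rewrite y0 ltW.
Qed.

(** Bounding the minimum by a small power of its second argument gives a factor geometric in [n] at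
    the cost of a small power of [aniso], which the gap [theta_lt] affords. The weight [w = 1]
    serves the field itself, [w l = l 0 j ^+ 2] its divided differences. *)
Lemma spectral_increment_bound : exists C r : R, 0 < r < 1 /\
  forall n i, (\int[lebesgue_tuple R N]_x
     (w (row_of_tuple x) * Num.min 1 ((2 ^- n * row_of_tuple x 0 i) ^+ 2) *
      f (row_of_tuple x))%:E <= (C * (r ^+ 4) ^+ n)%:E)%E.
Proof.
have [a /andP[a0 a1] aP] := aniso_lower_bound.
(* One half of the gap, [eta], pays for that power; the other half keeps [kappa] above [Q]. *)
pose eta := (gamma - Q - theta) / 2.
pose kappa := gamma - theta - eta.
have [eta0 Qk] : 0 < eta /\ Q < kappa.
  by rewrite /kappa /eta; move: theta_lt; move: Q => q tl; split; lra.
(* [e = S^-1] is at most 1 and satisfies [2 * e / beta j <= eta] for all [j] at once. *)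
pose S := 1 + \sum_(j < N) 2 / (eta * beta j).
have t0 j : 0 <= 2 / (eta * beta j) by rewrite divr_ge0// mulr_ge0// ltW.
have S1 : 1 <= S by rewrite lerDl sumr_ge0.
have S0 : 0 < S by apply: lt_le_trans S1.
pose e := S^-1.
have e01 : 0 < e <= 1 by rewrite invr_gt0 S0 invf_le1.
have e0 : 0 < e by case/andP: e01.
have e_eta j : 2 * e / beta j <= eta.
  have tS : 2 / (eta * beta j) <= S.
    by rewrite /S (bigD1 j)//= addrCA lerDl addr_ge0// sumr_ge0.
  have -> : 2 * e / beta j = eta * (2 / (eta * beta j) / S).
    by rewrite /e; field; rewrite !gt_eqF.
  by rewrite ler_piMr ?(ltW eta0)// ler_pdivrMr// mul1r.
(* Chosen so that [(r ^+ 4) ^+ n] is [(2 ^- n) ^+ 2] to the power [e]. *)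
pose r : R := 4 `^ (- e / 4).
have r4 : r ^+ 4 = 4 `^ (- e).
  by rewrite /r -(powR_mulrn 4 (powR_ge0 4 (- e / 4))) -powRrM divfK.
have r0 : 0 < r by rewrite powR_gt0.
have r1 : r < 1.
  rewrite /r /powR pnatr_eq0/= -[ltRHS]expR0 ltr_expR pmulr_llt0 ?ln_gt0 ?ltr1n//.
  by rewrite pmulr_llt0// oppr_lt0.
pose D := [set x : N.-tuple R | a <= aniso beta (row_of_tuple x)].
have mD : measurable D.
  by rewrite -[D]setTI; apply: measurable_fun_le => //; exact: measurable_aniso.
pose h1 (x : N.-tuple R) :=
  eucl (row_of_tuple x) ^+ 2 / (1 + eucl (row_of_tuple x) ^+ 2) * f (row_of_tuple x).
pose h2 (x : N.-tuple R) := aniso beta (row_of_tuple x) `^ (- kappa) * \1_D x.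
pose A := (1 + c3 ^+ 2) ^+ 2.
pose B := c2 * a `^ (- eta).
have A0 : 0 <= A by exact: sqr_ge0.
have B0 : 0 <= B by rewrite mulr_ge0 ?powR_ge0 ?ltW.
(* [h1] serves the low frequencies, through the integrability condition of the spectral density, and
   [h2] the high ones, through the upper bound on [f]. *)
pose G x := A * h1 x + B * h2 x.
have h1_ge0 x : 0 <= h1 x by rewrite mulr_ge0// divr_ge0 ?addr_ge0 ?sqr_ge0.
have h2_ge0 x : 0 <= h2 x by rewrite mulr_ge0 ?powR_ge0.
have mh1 : measurable_fun setT h1.
  by apply: measurable_funM => //; exact: measurable_spectral_weight.
have mh2 : measurable_fun setT h2.
  apply: measurable_funM; last exact: measurable_indic.
  by apply: (measurableT_comp (measurable_powR (- kappa))); exact: measurable_aniso.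
have mG : measurable_fun setT G.
  by apply: measurable_funD; apply: measurable_funM.
have G0 x : 0 <= G x by rewrite addr_ge0// mulr_ge0.
have h2_int : (\int[lebesgue_tuple R N]_x (h2 x)%:E < +oo)%E.
  rewrite [X in (X < _)%E](_ : _ = \int[lebesgue_tuple R N]_(x in D)
     (aniso beta (row_of_tuple x) `^ (- kappa))%:E)%E; last first.
    rewrite [RHS]integral_mkcond; apply: eq_integral => x _.
    by rewrite /h2 patchE indicE; case: ifP => _ /=; rewrite ?mulr1 ?mulr0.
  exact: aniso_integral_lty.
have G_int : (\int[lebesgue_tuple R N]_x (G x)%:E < +oo)%E.
  rewrite [X in (X < _)%E](_ : _ = \int[lebesgue_tuple R N]_x
      (A%:E * (h1 x)%:E + B%:E * (h2 x)%:E))%E; last first.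
    by apply: eq_integral => x _; rewrite -!EFinM -EFinD.
  rewrite ge0_integralD//=; last 4 first.
  - by move=> x _; rewrite -EFinM lee_fin mulr_ge0.
  - by apply/measurable_EFinP; exact: measurable_funM.
  - by move=> x _; rewrite -EFinM lee_fin mulr_ge0.
  - by apply/measurable_EFinP; exact: measurable_funM.
  rewrite !ge0_integralZl ?lee_fin//; try exact/measurable_EFinP; try by move=>
      x _; rewrite lee_fin.
  by apply: lte_add_pinfty; apply: lte_mul_pinfty.
exists (fine (\int[lebesgue_tuple R N]_x (G x)%:E)%E), r; split; first by rewrite r0.
move=> n i; apply: integral_le_dominated => //.
- apply: measurable_funM => //; apply: measurable_funM => //.
  apply: measurable_minr => //; apply: measurable_funX.
  by apply: measurable_funM => //; exact: measurable_coord.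
- move=> x; set l := row_of_tuple x.
  have min0 : 0 <= Num.min 1 ((2 ^- n * l 0 i) ^+ 2) by rewrite le_min ler01 sqr_ge0.
  rewrite mulr_ge0//= ?mulr_ge0//.
  have q4 : (r ^+ 4) ^+ n = ((2 ^- n) ^+ 2) `^ e.
    have -> : ((2 : R) ^- n) ^+ 2 = 4 `^ (- n%:R).
      have e4 : ((2 : R) ^+ n) ^+ 2 = 4 ^+ n by rewrite -exprM mulnC exprM -natrX.
      by rewrite exprVn e4 powRN powR_mulrn.
    by rewrite r4 -(powR_mulrn n (powR_ge0 4 (- e))) -!powRrM !mulNr mulrC.
  have [c3l|c3l] := leP c3 (eucl l).
    have al := aP _ c3l.
    have an0 : 0 < aniso beta l by apply: lt_le_trans al.
    have Dx : D x by [].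
    apply: (@le_trans _ _ ((r ^+ 4) ^+ n * (B * h2 x))); last first.
      by rewrite ler_wpM2l ?exprn_ge0 ?(ltW r0)// lerDr mulr_ge0.
    rewrite /h2 indicE mem_set// mulr1 -/l.
    have m1 : Num.min 1 ((2 ^- n * l 0 i) ^+ 2) <=
        (r ^+ 4) ^+ n * (a `^ (- eta) * aniso beta l `^ eta).
      apply: (le_trans (min1_le_powR (sqr_ge0 _) e01)).
      rewrite exprMn powRM ?sqr_ge0// -q4 ler_wpM2l ?exprn_ge0 ?(ltW r0)//.
      rewrite -(real_normK (num_real (l 0 i))) -powR_mulrn// -powRrM.
      apply: (le_trans (coord_powR_le_aniso beta_gt0 _ _ _)).
        by rewrite mulr_ge0// ltW.
      (* Dividing by [a] brings the base above 1, where raising the exponent from [2 * e / beta i]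
         to [eta] increases the power; the price is the factor of exponent [- eta] in [B]. *)
      have la : 1 <= aniso beta l / a by rewrite ler_pdivlMr// mul1r.
      have anE p : aniso beta l `^ p = a `^ p * (aniso beta l / a) `^ p.
        by rewrite -powRM ?divr_ge0 ?(ltW a0) ?(ltW an0)// mulrCA divff ?mulr1 ?gt_eqF.
      rewrite (anE eta) mulrA -powRD ?(gt_eqF a0) ?implybT// addNr powRr0 mul1r.
      rewrite anE -[leRHS]mul1r ler_pM ?powR_ge0//.
        rewrite -[leRHS](powRr0 a) ger_powR ?a0//.
        by rewrite divr_ge0 ?mulr_ge0 ?(ltW e0) ?(ltW (beta_gt0 _)).
      by rewrite ler_powR.
    have wm : w l * Num.min 1 ((2 ^- n * l 0 i) ^+ 2) <=
        aniso beta l `^ theta * ((r ^+ 4) ^+ n * (a `^ (- eta) * aniso beta l `^ eta)).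
      by apply: ler_pM => //; exact: w_aniso.
    have := ler_pM (mulr_ge0 (w_ge0 l) min0) (f_ge0 l) wm (f_ub c3l).
    move/le_trans; apply; rewrite le_eqVlt; apply/orP; left; apply/eqP.
    have -> : - kappa = theta + eta - gamma by rewrite /kappa; ring.
    rewrite powRB ?(gt_eqF an0) ?implybT// powRD ?(gt_eqF an0) ?implybT// /B.
    by ring.
  (* Low frequencies: one factor [1 + dotp l l] of [A] comes from [w], the other restores the
     denominator in [h1]. *)
  apply: (@le_trans _ _ ((r ^+ 4) ^+ n * (A * h1 x))); last first.
    by rewrite ler_wpM2l ?exprn_ge0 ?(ltW r0)// lerDl mulr_ge0.
  have dc : dotp l l <= c3 ^+ 2.
    by move: c3l; rewrite ltNge eucl_le_dotp ?(ltW c3_gt0)// -ltNge => /ltW.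
  have d0 := dotp_ge0 l.
  have m1 : Num.min 1 ((2 ^- n * l 0 i) ^+ 2) <= (r ^+ 4) ^+ n * dotp l l.
    apply: (@le_trans _ _ ((2 ^- n * l 0 i) ^+ 2)); first by rewrite ge_min lexx orbT.
    rewrite exprMn ler_pM ?sqr_ge0// ?coord_sqr_le_dotp// q4.
    apply: ger1_powR; last by case/andP: e01.
    by rewrite exprn_gt0 ?invr_gt0 ?exprn_gt0//= exprn_ile1 ?invr_ge0
        ?exprn_ge0// invf_le1 ?exprn_gt0// exprn_ege1// ler1n.
  have wm : w l * Num.min 1 ((2 ^- n * l 0 i) ^+ 2) <=
      (1 + dotp l l) * ((r ^+ 4) ^+ n * dotp l l) by apply: ler_pM.
  have := ler_wpM2r (f_ge0 l) wm; move/le_trans; apply.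
  rewrite /h1 -/l eucl_sqr /A.
  have -> : (1 + dotp l l) * ((r ^+ 4) ^+ n * dotp l l) * f l =
      (r ^+ 4) ^+ n * ((1 + dotp l l) ^+ 2 * (dotp l l / (1 + dotp l l) * f l)).
    by field; rewrite gt_eqF// ltr_wpDr.
  rewrite ler_wpM2l ?exprn_ge0 ?(ltW r0)// ler_wpM2r//.
    by rewrite mulr_ge0// divr_ge0// addr_ge0.
  by rewrite lerXn2r ?nnegrE ?addr_ge0 ?sqr_ge0// lerD2l.
- by rewrite exprn_ge0// exprn_ge0// ltW.
Qed.

End spectral_increment.

(** * Spectral representation of second moments *)

Section spectral_moments.
Context {R : realType} {d : measure_display} {T : measurableType d}.
Context {P : probability T R} {N : nat}.
Variables (X : 'rV[R]_N -> {RV P >-> R}) (f : 'rV[R]_N -> R).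
Hypothesis X_gauss : gaussian_field X.
Hypothesis X_spec : spectral_density X f.

Local Notation mu := (lebesgue_tuple R N).

Let f_ge0 l : 0 <= f l. Proof. by case: X_spec. Qed.

Let mf : measurable_fun [set: N.-tuple R] (fun x => f (row_of_tuple x)).
Proof. by case: X_spec. Qed.

Definition wave (t : 'rV[R]_N) (x : N.-tuple R) : R[i] :=
  expi (dotp t (row_of_tuple x)) - 1.

Lemma measurable_sin : measurable_fun [set: R] sin.
Proof. by apply: continuous_measurable_fun; exact: continuous_sin. Qed.

Lemma measurable_cos : measurable_fun [set: R] cos.
Proof. by apply: continuous_measurable_fun; exact: continuous_cos. Qed.

Lemma measurable_Re_wave t : measurable_fun setT (fun x => complex.Re (wave t x)).
Proof.
apply: measurable_funB => //.
by apply: (measurableT_comp measurable_cos); exact: measurable_dotp.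
Qed.

Lemma measurable_Im_wave t : measurable_fun setT (fun x => complex.Im (wave t x)).
Proof.
apply: measurable_funB => //.
by apply: (measurableT_comp measurable_sin); exact: measurable_dotp.
Qed.

(** The real part of [wave s] times the conjugate of [wave t], times the density, written bilinearly
    in real components. *)
Definition spectral_kernel s t (x : N.-tuple R) : R :=
  (complex.Re (wave s x) * complex.Re (wave t x) +
   complex.Im (wave s x) * complex.Im (wave t x)) * f (row_of_tuple x).

Lemma spectral_kernelE s t x : spectral_kernel s t x =
  complex.Re ((expi (dotp s (row_of_tuple x)) - 1) *
    (expi (- dotp t (row_of_tuple x)) - 1) * real_complex R (f (row_of_tuple x))).
Proof. by rewrite /spectral_kernel /= cosN sinN; ring. Qed.

Lemma measurable_spectral_kernel s t : measurable_fun setT (spectral_kernel s t).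
Proof.
apply: measurable_funM => //; apply: measurable_funD; apply: measurable_funM;
  by [exact: measurable_Re_wave|exact: measurable_Im_wave].
Qed.

(** Multiplied by 1 + |l|^2, the left-hand side splits into two terms: the quadratic bound is used
    for the first, the bound 4 for the second. *)
Lemma sqn_wave_le t : exists2 c : R, 0 <= c &
  forall x : N.-tuple R, sqn (wave t x) <=
    c * (eucl (row_of_tuple x) ^+ 2 / (1 + eucl (row_of_tuple x) ^+ 2)).
Proof.
pose a := \sum_(j < N) `|t 0 j|.
have a0 : 0 <= a by exact: sumr_ge0.
exists (a ^+ 2 + 4) => [|y]; first by rewrite addr_ge0 ?sqr_ge0.
set l := row_of_tuple y; have d0 := dotp_ge0 l.
rewrite eucl_sqr mulrA ler_pdivlMr ?ltr_wpDr//.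
have h4 := sqn_expiB1_le4 (dotp t l); have h2 := sqn_expiB1_le (dotp t l).
have ha : dotp t l ^+ 2 <= a ^+ 2 * dotp l l.
  have : `|dotp t l| <= a * eucl l.
    rewrite /a mulr_suml; apply: (le_trans (ler_norm_sum _ _ _)).
    apply: ler_sum => j _; rewrite normrM ler_wpM2l//.
    by rewrite -ler_sqr ?nnegrE ?sqrtr_ge0// real_normK ?num_real// eucl_sqr
        coord_sqr_le_dotp.
  move=> ae; rewrite -eucl_sqr -exprMn -(real_normK (num_real (dotp t l))).
  have ae0 : 0 <= a * eucl l by rewrite mulr_ge0// sqrtr_ge0.
  by rewrite lerXn2r ?nnegrE.
rewrite -/(wave t y) in h4 h2; rewrite mulrDr mulr1 (mulrDl (a ^+ 2) 4).
apply: lerD; first exact: le_trans ha.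
by rewrite ler_wpM2r.
Qed.

Lemma spectral_kernel_integrable s t :
  mu.-integrable setT (EFin \o spectral_kernel s t).
Proof.
have [cs cs0 hs] := sqn_wave_le s.
have [ct ct0 ht] := sqn_wave_le t.
have [_ _ _ fint _] := X_spec.
pose h (x : N.-tuple R) := eucl (row_of_tuple x) ^+ 2 /
  (1 + eucl (row_of_tuple x) ^+ 2) * f (row_of_tuple x).
have mh : measurable_fun setT h.
  by apply: measurable_funM => //; exact: measurable_spectral_weight.
have h0 x : 0 <= h x by rewrite mulr_ge0// divr_ge0 ?addr_ge0 ?sqr_ge0.
have hint : mu.-integrable setT (EFin \o h).
  apply/integrableP; split; first exact/measurable_EFinP.
  by under eq_integral do rewrite /= ger0_norm//.
apply: (le_integrable measurableT) (integrableZl measurableT (cs + ct) hint).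
  by apply/measurable_EFinP; exact: (measurable_spectral_kernel s t).
move=> x _ /=; rewrite lee_fin [leRHS]ger0_norm; last first.
  by apply: mulr_ge0; [exact: addr_ge0|exact: h0].
rewrite /spectral_kernel normrM (ger0_norm (f_ge0 _)) /h mulrA ler_wpM2r//.
have := hs x; have := ht x; rewrite /sqn.
set a := complex.Re _; set b := complex.Im _; set a' := complex.Re _; set b' :=
    complex.Im _.
move: (_ / _) => q h1 h2.
have h3 := sqr_ge0 (a - a'); have h4 := sqr_ge0 (b - b').
have h5 := sqr_ge0 (a + a'); have h6 := sqr_ge0 (b + b').
have h7 := sqr_ge0 a; have h8 := sqr_ge0 b; have h9 := sqr_ge0 a'; have h10 :=
    sqr_ge0 b'.
rewrite ler_norml; apply/andP; split; lra.
Qed.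

Lemma gaussian_field_rv t : gaussian_rv P (X t).
Proof.
have := X_gauss (fun _ : 'I_1 => 1) (fun _ => t).
by congr (gaussian_rv P _); apply/funext => w; rewrite big_ord1 mul1r.
Qed.

Lemma square_integrable t : P.-integrable setT (EFin \o (fun w => X t w ^+ 2)).
Proof.
apply/integrableP; split; first by apply/measurable_EFinP; exact: measurable_funX.
have := gaussian_second_moment_lty (gaussian_field_rv t); rewrite unlock.
apply: le_lt_trans; rewrite le_eqVlt; apply/orP; left; apply/eqP.
by apply: eq_integral => w _; rewrite /= ger0_norm ?sqr_ge0.
Qed.

Lemma product_integrable s t :
  P.-integrable setT (EFin \o (fun w => X s w * X t w)).
Proof.
apply: (le_integrable measurableT) (integrableD measurableT (square_integrable
    s) (square_integrable t)).
  by apply/measurable_EFinP; exact: measurable_funM.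
move=> w _ /=; rewrite lee_fin [leRHS]ger0_norm ?addr_ge0 ?sqr_ge0//.
have := sqr_ge0 (X s w - X t w); have := sqr_ge0 (X s w + X t w).
have := sqr_ge0 (X s w); have := sqr_ge0 (X t w).
rewrite ler_norml => *; apply/andP; split; lra.
Qed.

Lemma covariance_funE s t :
  (\int[P]_w (X s w * X t w)%:E = (covariance_fun X s t)%:E)%E.
Proof.
rewrite /covariance_fun unlock fineK//.
exact: integrable_fin_num (product_integrable s t).
Qed.

(** Expressed through [covariance_fun], so that continuity of the covariance yields mean-square
    continuity of the field. *)
Lemma second_moment_difference s t :
  ('E_P[fun w => ((X s w - X t w) ^+ 2)%R] =
   (covariance_fun X s s - 2 * covariance_fun X s t + covariance_fun X t t)%:E)%E.
Proof.
have ist := product_integrable.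
have i2 : P.-integrable setT (fun w => ((-2)%:E * (X s w * X t w)%:E)%E).
  by apply: integrableZl => //; exact: ist.
rewrite unlock; transitivity (\int[P]_w ((X s w * X s w)%:E +
    (-2)%:E * (X s w * X t w)%:E + (X t w * X t w)%:E))%E.
  apply: eq_integral => w _; rewrite -EFinM -!EFinD; congr (_%:E); ring.
rewrite integralD//; [|exact: (integrableD measurableT (ist s s) i2)|exact: ist].
rewrite integralD//; last exact: ist.
rewrite integralZl//; last exact: ist.
by rewrite !covariance_funE -EFinM -!EFinD mulNr.
Qed.

Lemma covariance_spectral s t :
  (\int[P]_w (X s w * X t w)%:E = \int[mu]_x (spectral_kernel s t x)%:E)%E.
Proof.
have [_ _ _ _ /(_ s t)/(congr1 (@complex.Re R))] := X_spec.
rewrite /= => e2; rewrite covariance_funE e2.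
rewrite /Rintegral fineK//.
  by apply: eq_integral => x _; rewrite spectral_kernelE.
have := integrable_fin_num measurableT (spectral_kernel_integrable s t).
congr (_ \is a fin_num); apply: eq_integral => x _.
by rewrite /= spectral_kernelE.
Qed.

(** The squared modulus of the Fourier symbol of the functional summing [a k * X (t k)]. *)
Definition spectral_weight n (a : 'I_n -> R) (t : 'I_n -> 'rV[R]_N)
    (x : N.-tuple R) : R :=
  sqn (\sum_(k < n) real_complex R (a k) * wave (t k) x).

Lemma sqn_sum n (a : 'I_n -> R) (z : 'I_n -> R[i]) :
  sqn (\sum_(k < n) real_complex R (a k) * z k) =
  \sum_p (a p.1 * a p.2) * (complex.Re (z p.1) * complex.Re (z p.2) +
                            complex.Im (z p.1) * complex.Im (z p.2)).
Proof.
have re : complex.Re (\sum_(k < n) real_complex R (a k) * z k) =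
          \sum_(k < n) a k * complex.Re (z k).
  rewrite raddf_sum; apply: eq_bigr => k _.
  by case: (z k) => u v /=; ring.
have im : complex.Im (\sum_(k < n) real_complex R (a k) * z k) =
          \sum_(k < n) a k * complex.Im (z k).
  rewrite raddf_sum; apply: eq_bigr => k _.
  by case: (z k) => u v /=; ring.
rewrite /sqn re im !expr2 !big_distrlr/= !pair_bigA/= -big_split/=.
by apply: eq_bigr => p _; ring.
Qed.

(** Both sides are quadratic forms in [a], with covariances on one side and integrated kernels on
    the other; [covariance_spectral] matches the coefficients. *)
Lemma second_moment_spectral n (a : 'I_n -> R) (t : 'I_n -> 'rV[R]_N) :
  ('E_P[fun w => ((\sum_(k < n) a k * X (t k) w) ^+ 2)%R] =
   \int[mu]_x (spectral_weight a t x * f (row_of_tuple x))%:E)%E.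
Proof.
rewrite unlock.
transitivity (\sum_(p : 'I_n * 'I_n)
    (a p.1 * a p.2)%:E * (\int[mu]_x (spectral_kernel (t p.1) (t p.2) x)%:E))%E.
  transitivity (\int[P]_w \sum_(p : 'I_n * 'I_n)
      ((a p.1 * a p.2)%:E * (X (t p.1) w * X (t p.2) w)%:E))%E.
    apply: eq_integral => w _; rewrite expr2 big_distrlr/= pair_bigA/= -sumEFin.
    by apply: eq_bigr => p _; rewrite -EFinM; congr (_%:E); ring.
  rewrite integral_sum//; last first.
    by move=> p; apply: integrableZl => //; exact: product_integrable.
  apply: eq_bigr => p _; rewrite -covariance_spectral integralZl//.
  exact: product_integrable.
transitivity (\int[mu]_x \sum_(p : 'I_n * 'I_n)
    ((a p.1 * a p.2)%:E * (spectral_kernel (t p.1) (t p.2) x)%:E))%E.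
  rewrite integral_sum//; last first.
    by move=> p; apply: integrableZl => //; exact: spectral_kernel_integrable.
  apply: eq_bigr => p _; rewrite integralZl//.
  exact: spectral_kernel_integrable.
apply: eq_integral => x _; rewrite /spectral_weight sqn_sum mulr_suml -sumEFin.
by apply: eq_bigr => p _; rewrite -EFinM; congr (_%:E); rewrite /spectral_kernel; ring.
Qed.

Lemma measurable_spectral_weight_sum n (a : 'I_n -> R) (t : 'I_n -> 'rV[R]_N) :
  measurable_fun setT (fun x => spectral_weight a t x * f (row_of_tuple x)).
Proof.
apply: measurable_funM => //; rewrite /spectral_weight.
under eq_fun do rewrite sqn_sum.
apply: measurable_sum => p; apply: measurable_funM => //.
apply: measurable_funD; apply: measurable_funM;
  by [exact: measurable_Re_wave|exact: measurable_Im_wave].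
Qed.

End spectral_moments.

(** * Divided differences *)

Section row_vectors.
Context {R : realType}.

Lemma cvg_rV {m : nat} {I : Type} {F : set_system I} {FF : Filter F}
    (u : I -> 'rV[R]_m) (t : 'rV[R]_m) :
  (forall i, u x 0 i @[x --> F] --> t 0 i) -> u x @[x --> F] --> t.
Proof.
move=> ut A [B tB BA].
have : \forall x \near F, forall i, B 0 i (u x 0 i).
  by apply: filter_forall => i; exact: ut (tB 0 i).
by apply: filterS => x uB; apply: BA => i j; rewrite (ord1 i); exact: uB.
Qed.

Lemma dyadic_floor_cvg {m : nat} (t : 'rV[R]_m) :
  dyadic n (dyadic_floor n t) @[n --> \oo] --> t.
Proof.
apply: cvg_rV => i.
apply/cvgrPdist_le => e e0.
have [n0 n0e] := @expr_small R 2^-1 e (ltac:(lra)) e0.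
near=> n.
have n0n : (n0 <= n)%N by near: n; exact: nbhs_infty_ge.
rewrite !mxE.
have p0 : (0 : R) < 2 ^+ n by rewrite exprn_gt0.
have /andP[t1 t2] := floor_itv (2 ^+ n * t 0 i).
apply: (@le_trans _ _ (2 ^- n)); last first.
  apply: le_trans n0e; rewrite -exprVn.
  by apply: ler_wiXn2l => //; lra.
have -> : t 0 i - (Num.floor (2 ^+ n * t 0 i))%:~R / 2 ^+ n =
    (2 ^+ n * t 0 i - (Num.floor (2 ^+ n * t 0 i))%:~R) / 2 ^+ n.
  by field; rewrite gt_eqF.
rewrite normrM [X in _ * X]gtr0_norm ?invr_gt0// ler_piMl ?invr_ge0 ?(ltW p0)//.
by rewrite ger0_norm; move: t2; rewrite intrD; lra.
Unshelve. all: by end_near.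
Qed.

Definition row_pair {N : nat} (t : 'rV[R]_N) (h : R) : 'rV[R]_(N + 1) :=
  row_mx t (const_mx h).

Lemma row_pair_cvg {N : nat} {I : Type} {F : set_system I} {FF : Filter F}
    (u : I -> 'rV[R]_N) (h : I -> R) (t : 'rV[R]_N) (a : R) :
  u x @[x --> F] --> t -> h x @[x --> F] --> a ->
  row_pair (u x) (h x) @[x --> F] --> row_pair t a.
Proof.
move=> ut ha; apply: cvg_rV => i.
have [[k ->]|[k ->]] : (exists k, i = lshift 1 k) \/ (exists k, i = rshift N k).
- by case: (split_ordP i) => k ->; [left|right]; exists k.
- rewrite row_mxEl; under eq_fun do rewrite row_mxEl.
  have H := @cvg_comp _ _ _ u (fun M : 'rV[R]_N => M 0 k) _ _ _ ut
      (@coord_continuous R 1 N 0 k t).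
  by move=> B tB; exact: (H B tB).
- rewrite row_mxEr mxE; under eq_fun do rewrite row_mxEr mxE.
  exact: ha.
Qed.

End row_vectors.

Section divided_differences.
Context {R : realType} {N : nat}.
Implicit Types (y : 'rV[R]_N -> R) (g : 'rV[R]_(N + 1) -> R) (t u : 'rV[R]_N).

(** At [h = 0] the equation reads [0 = 0]: there [g] is determined by continuity alone, which is
    therefore required jointly in [(t, h)]. *)
Definition divided_difference y j g := continuous g /\
  forall t h, y (t + h *: basis_vec R j) - y t = h * g (row_pair t h).

Lemma divided_difference_cvg y j g t : divided_difference y j g ->
  h^-1 *: ((y \o shift t) (h *: basis_vec R j) - y t) @[h --> 0^'] -->
  g (row_pair t 0).
Proof.
move=> [cg yg].
have H : g (row_pair t h) @[h --> 0^'] --> g (row_pair t 0).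
  apply: (@cvg_comp _ _ _ (fun h : R => row_pair t h) g); last exact: cg.
  apply: row_pair_cvg; first exact: cvg_cst.
  exact: cvg_within.
apply: cvg_trans H; apply: near_eq_cvg.
near=> h.
have h0 : h != 0 by near: h; exact: nbhs_dnbhs_neq.
by rewrite /comp /shift [_ + t]addrC yg /GRing.scale /= mulKf.
Unshelve. all: by end_near.
Qed.

Lemma divided_difference_partial y j g t : divided_difference y j g ->
  partial_derivable y j t /\ partial y j t = g (row_pair t 0).
Proof.
move=> yg; have c := @divided_difference_cvg _ _ _ t yg.
split; first by apply/cvg_ex; exists (g (row_pair t 0)).
exact/cvg_lim.
Qed.

Lemma divided_difference_continuous y j g : divided_difference y j g ->
  continuous (partial y j).
Proof.
move=> yg; have -> : partial y j = fun t => g (row_pair t 0).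
  by apply/funext => t; have [] := @divided_difference_partial _ _ _ t yg.
move=> t; have FF : Filter (nbhs t) := nbhs_filter t.
apply: (@cvg_comp _ _ _ (fun t => row_pair t 0) g); last by case: yg => + _; exact.
by apply: row_pair_cvg; [exact: cvg_id|exact: cvg_cst].
Qed.

(* Moving from t to t + h u one coordinate at a time turns the increment into
   a sum of divided differences, whose joint continuity absorbs the moving
   base points. *)
Lemma divided_difference_directional y (g : 'I_N -> 'rV[R]_(N + 1) -> R) t u :
  (forall j, divided_difference y j (g j)) ->
  (y (t + h *: u) - y t - h * dotp u (gradient y t)) / h @[h --> 0^'] --> (0 : R).
Proof.
move=> yg.
pose p a : 'rV[R]_N := \row_i (if (i < a)%N then u 0 i else 0).
have p0 : p 0%N = 0 by apply/rowP => i; rewrite !mxE.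
have pN : p N = u by apply/rowP => i; rewrite !mxE ltn_ord.
have pS (j : 'I_N) : p j.+1 = p j + u 0 j *: basis_vec R j.
  apply/rowP => i; rewrite !mxE eqxx /= ltnS leq_eqVlt.
  have [->|ij] := eqVneq i j; first by rewrite eqxx ltnn add0r mulr1.
  have -> : (i == j :> nat) = false by apply: contra_neqF ij => /eqP; exact: val_inj.
  by rewrite mulr0 addr0.
(* The step [h * u 0 j] may be 0; the identity, being multiplied by the step, still holds then. *)
pose G h (j : 'I_N) := g j (row_pair (t + h *: p j) (h * u 0 j)).
have tele h : y (t + h *: u) - y t = \sum_(j < N) h * u 0 j * G h j.
  rewrite -{1}pN -[X in _ - y X]addr0 -(scaler0 _ h) -p0.
  rewrite -(telescope_sumr (fun a => y (t + h *: p a)) (leq0n N)) big_mkord.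
  apply: eq_bigr => j _; rewrite pS scalerDr scalerA addrA.
  by have [_ ->] := yg j.
have GE h : h != 0 -> (y (t + h *: u) - y t - h * dotp u (gradient y t)) / h =
    \sum_(j < N) u 0 j * (G h j - g j (row_pair t 0)).
  move=> h0; rewrite tele /dotp mulr_sumr -sumrB mulr_suml; apply: eq_bigr => j _.
  have [_ e] := @divided_difference_partial _ _ _ t (yg j).
  by rewrite mxE e; field.
have Gc : \sum_(j < N) u 0 j * (G h j - g j (row_pair t 0)) @[h --> 0^'] --> (0 : R).
  rewrite [X in _ --> X](_ : _ = \sum_(j < N) u 0 j * (g j (row_pair t 0) - g j
      (row_pair t 0))); last first.
    by rewrite big1// => j _; rewrite subrr mulr0.
  have id0 : h @[h --> (0:R)^'] --> (0 : R) by exact: cvg_within.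
  apply: cvg_big => [|j _]; first exact: add_continuous.
  apply: cvgM; first exact: cvg_cst.
  apply: cvgB; last exact: cvg_cst.
  apply: (@cvg_comp _ _ _ (fun h : R => row_pair (t + h *: p j) (h * u 0 j)) (g j));
    last by have [cg _] := yg j; exact: cg.
  apply: row_pair_cvg.
    rewrite -[X in _ --> X]addr0; apply: cvgD; first exact: cvg_cst.
    by rewrite -(scale0r (p j)); apply: cvgZl.
  by rewrite -[X in _ --> X](mul0r (u 0 j)); apply: cvgM => //; exact: cvg_cst.
apply: cvg_trans Gc; apply: near_eq_cvg; near=> h; rewrite GE//.
by near: h; exact: nbhs_dnbhs_neq.
Unshelve. all: by end_near.
Qed.

End divided_differences.

(** * Versions of the field and of its divided differences *)

Lemma cvg_pair_rV {R : realType} {N : nat} (u v : nat -> 'rV[R]_N) (s t : 'rV[R]_N) :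
  u n @[n --> \oo] --> s -> v n @[n --> \oo] --> t ->
  (u n, v n) @[n --> \oo] --> (s, t).
Proof.
move=> us vt.
exact: (@cvg_pair _ _ _ _ _ _ _ (nbhs_filter s) (nbhs_filter t) _ _ us vt).
Qed.

Section limits_of_random_variables.
Context {R : realType} {d : measure_display} {T : measurableType d}.
Context {P : probability T R}.
Implicit Types (Y Z V : {RV P >-> R}).

Lemma ae_prob1 (A : T -> Prop) : measurable [set w | A w] ->
  {ae P, forall w, A w} -> P [set w | A w] = 1%E.
Proof.
move=> mA hA.
have nA : P (~` [set w | A w]) = 0%E.
  by apply: measure_negligible => //; exact: measurableC.
by rewrite -[X in P X]setCK probability_setC ?nA ?sube0//; exact: measurableC.
Qed.

Lemma measurable_rv_eq Y Z : measurable [set w | Y w = Z w].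
Proof.
rewrite (_ : [set w | _] = (Y \- Z) @^-1` [set 0]); last first.
  apply/seteqP; split => w /= /eqP; first by move=> /eqP ->; rewrite subrr.
  by rewrite subr_eq0 => /eqP.
by rewrite -[X in measurable X]setTI; apply: measurable_funB.
Qed.

Lemma is_version_ae N (X Y : 'rV[R]_N -> {RV P >-> R}) t : is_version X Y ->
  {ae P, forall w, Y t w = X t w}.
Proof.
move=> /(_ t) YX; have mYX := measurable_rv_eq (Y t) (X t).
exists (~` [set w | Y t w = X t w]); split=> //; first exact: measurableC.
by rewrite probability_setC// YX subee.
Qed.

Lemma ae_forall_countable (I : countType) (A : I -> T -> Prop) :
  (forall i, {ae P, forall w, A i w}) -> {ae P, forall w, forall i, A i w}.
Proof.
move=> hA.
have : {ae P, forall w, forall n, if unpickle n is Some i then A i w else True}.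
  by apply: ae_foralln => n; case: unpickle => [i|]; [exact: hA|exact: aeW].
by apply: filterS => w h i; have := h (pickle i); rewrite pickleK.
Qed.

(** Fatou: the mean square of [V - Y] is at most the lower limit of those of [Z n - Y], hence
    zero. *)
Lemma ae_limit_unique (Z : nat -> {RV P >-> R}) Y V (e : nat -> R) :
  {ae P, forall w, Z n w @[n --> \oo] --> V w} ->
  (forall n, ('E_P[fun w => ((Z n w - Y w) ^+ 2)%R] <= (e n)%:E)%E) ->
  e @ \oo --> (0 : R) -> {ae P, forall w, V w = Y w}.
Proof.
move=> [A [mA A0 AP]] ZY e0.
have mD : measurable (~` A) by exact: measurableC.
pose g n w : \bar R := ((Z n w - Y w) ^+ 2)%:E.
have mg n D : measurable_fun D (g n).
  apply: measurable_funTS; apply/measurable_EFinP/measurable_funX.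
  exact: measurable_funB.
have g0 n w : (0 <= g n w)%E by rewrite lee_fin sqr_ge0.
pose v w : \bar R := ((V w - Y w) ^+ 2)%:E.
have mv D : measurable_fun D v.
  apply: measurable_funTS; apply/measurable_EFinP/measurable_funX.
  exact: measurable_funB.
have gv w : (~` A) w -> g n w @[n --> \oo] --> v w.
  move=> Aw; have Zw : Z n w @[n --> \oo] --> V w.
    by apply: contrapT => h; exact/Aw/AP.
  apply: cvg_EFin; first by near=> n.
  have : (Z n w - Y w) * (Z n w - Y w) @[n --> \oo] --> (V w - Y w) * (V w - Y w).
    by apply: cvgM; (apply: cvgB; [exact: Zw|exact: cvg_cst]).
  by [].
have v_int : (\int[P]_(w in ~` A) v w = 0)%E.
  apply/eqP; rewrite eq_le integral_ge0 ?andbT; last first.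
    by move=> w _; rewrite lee_fin sqr_ge0.
  have -> : (\int[P]_(w in ~` A) v w = \int[P]_(w in ~` A) limn_einf (g^~ w))%E.
    apply: eq_integral => w /set_mem Aw; apply/esym.
    exact: (cvg_limn_einf_sup (gv w Aw)).1.
  apply: (le_trans (fatou P mD (fun n => mg n _) (fun n w _ => g0 n w))).
  rewrite le_eqVlt; apply/orP; left; apply/eqP.
  apply: (cvg_limn_einf_sup (l := 0%E) _).1.
  apply: (@squeeze_cvge _ _ _ _ (cst 0%E) _ (EFin \o e)).
  - apply: nearW => n; rewrite integral_ge0//=.
    apply: le_trans (ZY n); rewrite unlock.
    by apply: ge0_subset_integral => //; exact: mg.
  - exact: cvg_cst.
  - by apply: cvg_EFin => //; near=> n.
have : ae_eq P (~` A) v (cst 0%E).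
  apply/ae_eq_integral_abs => //.
  by rewrite -[RHS]v_int; apply: eq_integral => w _; rewrite gee0_abs// lee_fin sqr_ge0.
have nA : {ae P, forall w, (~` A) w} by exists A; split=> // w /= /contrapT.
apply: filterS2 nA => w Aw /(_ Aw)[] /eqP.
by rewrite sqrf_eq0 subr_eq0 => /eqP.
Unshelve. all: by end_near.
Qed.

End limits_of_random_variables.

Section shifts.
Context {R : realType} {N : nat}.

Lemma min1_bound (a b y : R) : 0 <= a -> 0 <= b -> b <= a ->
  y <= a -> forall q, 0 <= q -> y <= b * q -> y <= a * Num.min 1 q.
Proof.
move=> a0 b0 ba ya q q0 yq; have [q1|q1] := leP 1 q; first by rewrite mulr1.
by apply: (le_trans yq); rewrite ler_wpM2r.
Qed.

Lemma dotp_basis (l : 'rV[R]_N) i (h : R) : dotp (h *: basis_vec R i) l = h * l 0 i.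
Proof.
rewrite /dotp (bigD1 i)//= big1 ?addr0 => [|j ji]; first by rewrite !mxE !eqxx mulr1.
by rewrite !mxE eqxx (negbTE ji) /= mulr0 mul0r.
Qed.

Lemma dotpD (s t l : 'rV[R]_N) : dotp (s + t) l = dotp s l + dotp t l.
Proof. by rewrite /dotp -big_split/=; apply: eq_bigr => j _; rewrite mxE mulrDl. Qed.

(** The first factor has modulus 1, so the size of a spectral increment depends on the step and not
    on the base point. *)
Lemma wave_shift (t : 'rV[R]_N) (h : R) i (x : N.-tuple R) : wave (t + h *:
    basis_vec R i) x - wave t x =
  expi (dotp t (row_of_tuple x)) * (expi (h * row_of_tuple x 0 i) - 1).
Proof. by rewrite /wave dotpD expiD dotp_basis; ring. Qed.

Lemma dyadicD n (k : 'rV[int]_N) i :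
  dyadic n (k + delta_mx 0 i) = dyadic n k + 2 ^- n *: basis_vec R i.
Proof.
apply/rowP => j; rewrite !mxE intrD mulrDl eqxx/=; congr (_ + _).
by case: (j == i); rewrite /= mulrC.
Qed.

Lemma lsubmx_shiftl (x : 'rV[R]_(N + 1)) (c : R) (i : 'I_N) :
  lsubmx (x + c *: basis_vec R (lshift 1 i)) = lsubmx x + c *: basis_vec R i.
Proof. by apply/rowP => k; rewrite !mxE eq_lshift. Qed.

Lemma lsubmx_shiftr (x : 'rV[R]_(N + 1)) (c : R) (i : 'I_1) :
  lsubmx (x + c *: basis_vec R (rshift N i)) = lsubmx x.
Proof. by apply/rowP => k; rewrite !mxE eq_lrshift andbF mulr0 addr0. Qed.

Lemma last_shiftl (x : 'rV[R]_(N + 1)) (c : R) (i : 'I_N) :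
  (x + c *: basis_vec R (lshift 1 i)) 0 (rshift N 0) = x 0 (rshift N 0).
Proof. by rewrite !mxE eq_rlshift andbF mulr0 addr0. Qed.

Lemma last_shiftr (x : 'rV[R]_(N + 1)) (c : R) (i : 'I_1) :
  (x + c *: basis_vec R (rshift N i)) 0 (rshift N 0) = x 0 (rshift N 0) + c.
Proof. by rewrite !mxE eq_rshift (ord1 i) !eqxx mulr1. Qed.

(** Otherwise 3 would divide a power of 2. *)
Lemma dyadic_neq_third m n (k : 'rV[int]_m) i :
  (dyadic n k : 'rV[R]_m) 0 i + 3^-1 != 0.
Proof.
have p0 : (2 : R) ^+ n != 0 by rewrite expf_neq0.
rewrite mxE; apply/eqP => h.
have : ((3 * k 0 i + 2 ^+ n)%:~R : R) = 0.
  rewrite intrD intrM rmorphXn/=.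
  have -> : (3 : R) * (k 0 i)%:~R + 2 ^+ n =
      3 * 2 ^+ n * ((k 0 i)%:~R / 2 ^+ n + 3^-1) by field; rewrite p0.
  by rewrite h mulr0.
move/eqP; rewrite intr_eq0 addrC addr_eq0 => /eqP/(congr1 absz).
rewrite abszN abszM abszX /= => e.
have : (3 %| 2 ^ n)%N by rewrite e dvdn_mulr.
by rewrite Euclid_dvdX.
Qed.

End shifts.

(** * Regularity of the field from its spectral density *)

Section gaussian_field_regularity.
Context {R : realType} {d : measure_display} {T : measurableType d}.
Context {P : probability T R} {N : nat}.
Variables (X : 'rV[R]_N -> {RV P >-> R}) (f : 'rV[R]_N -> R).
Hypothesis X_gauss : gaussian_field X.
Hypothesis X_cov : continuous
  (fun st : 'rV[R]_N * 'rV[R]_N => covariance_fun X st.1 st.2).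
Hypothesis X_spec : spectral_density X f.
Variables (c2 c3 gamma : R) (beta : 'I_N -> R).
Hypotheses (c2_gt0 : 0 < c2) (c3_gt0 : 0 < c3).
Hypothesis beta_gt0 : forall j, 0 < beta j.
Hypothesis f_ub : forall l : 'rV[R]_N, c3 <= eucl l ->
  f l <= c2 / aniso beta l `^ gamma.

Local Notation Q := (\sum_(j < N) (beta j)^-1).
Local Notation mu := (lebesgue_tuple R N).

(** [C] and [r] precede the points and coefficients of the combination, so that a pointwise
    domination of spectral weights is all that each application has to check. *)
Lemma second_moment_increment (w : 'rV[R]_N -> R) (theta : R) :
  (forall l, 0 <= w l) ->
  measurable_fun setT (fun x : N.-tuple R => w (row_of_tuple x)) ->
  (forall l, w l <= 1 + dotp l l) ->
  (forall l, c3 <= eucl l -> w l <= aniso beta l `^ theta) ->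
  theta < gamma - Q ->
  exists C r : R, 0 < r < 1 /\
    forall n i m (a : 'I_m -> R) (t : 'I_m -> 'rV[R]_N) (c : R), 0 <= c ->
    (forall x, spectral_weight a t x <= c * (w (row_of_tuple x) *
       Num.min 1 ((2 ^- n * row_of_tuple x 0 i) ^+ 2))) ->
    ('E_P[fun w => ((\sum_(k < m) a k * X (t k) w) ^+ 2)%R] <=
     (c * C * (r ^+ 4) ^+ n)%:E)%E.
Proof.
move=> w0 mw w1 wa tQ.
have [f0 _ mf fint _] := X_spec.
have [C [r [r01 Cr]]] := @spectral_increment_bound _ _ _ _ _ _ _ beta_gt0 c2_gt0 c3_gt0
  f0 mf fint f_ub _ _ w0 mw w1 wa tQ.
exists C, r; split=> // n i m a t c c0 ac.
rewrite (second_moment_spectral X_gauss X_spec).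
have min0 x : 0 <= Num.min 1 ((2 ^- n * row_of_tuple x 0 i : R) ^+ 2).
  by rewrite le_min ler01 sqr_ge0.
have mmin : measurable_fun setT (fun x : N.-tuple R =>
    w (row_of_tuple x) * Num.min 1 ((2 ^- n * row_of_tuple x 0 i) ^+ 2) * f
        (row_of_tuple x)).
  apply: measurable_funM => //; apply: measurable_funM => //.
  apply: measurable_minr => //; apply: measurable_funX.
  by apply: measurable_funM => //; exact: measurable_coord.
rewrite -mulrA EFinM; apply: (@le_trans _ _ (c%:E * \int[mu]_x
   (w (row_of_tuple x) * Num.min 1 ((2 ^- n * row_of_tuple x 0 i) ^+ 2) *
      f (row_of_tuple x))%:E)%E); last first.
  by rewrite lee_wpmul2l// ?lee_fin// Cr.
rewrite -ge0_integralZl ?lee_fin//; [|exact/measurable_EFinP|]; last first.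
  by move=> x _; rewrite lee_fin !mulr_ge0.
apply: ge0_le_integral => //.
- by move=> x _; rewrite lee_fin mulr_ge0// sqn_ge0.
- by apply/measurable_EFinP; exact: (measurable_spectral_weight_sum X_spec).
- by apply/measurable_EFinP; exact: measurable_funM.
- by move=> x _; rewrite -EFinM lee_fin mulrA ler_wpM2r.
Qed.

(** Chaining with [w = 1] and [theta = 0]. The limit along the grid agrees with [X t] because the
    grid values also converge to it in mean square, by continuity of the covariance. *)
Lemma continuous_version : 0 < gamma - Q ->
  exists Y : 'rV[R]_N -> {RV P >-> R},
    is_version X Y /\ forall w, continuous (sample_path Y w).
Proof.
move=> gQ.
have [C [r [r01 Cr]]] := @second_moment_increment (fun=> 1) 0 (fun=> ler01)
  (measurable_cst _) (fun l => ltac:(rewrite lerDl; exact: dotp_ge0))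
  (fun l _ => ltac:(rewrite powRr0; exact: lexx)) gQ.
pose a (k : 'I_2) : R := nth 0 [:: 1; -1] k.
pose t2 (s t : 'rV[R]_N) (k : 'I_2) : 'rV[R]_N := nth 0 [:: s; t] k.
have incrE s t w : X s w - X t w = \sum_(k < 2) a k * X (t2 s t k) w.
  by rewrite !big_ord_recr big_ord0 /= add0r mul1r mulN1r.
have [V [cV V_lim]] : exists V : 'rV[R]_N -> {RV P >-> R},
    (forall w, continuous (sample_path V w)) /\
    {ae P, forall w, forall t,
       X (dyadic n (dyadic_floor n t)) w @[n --> \oo] --> V t w}.
  apply: (@kolmogorov_continuity _ _ _ _ _ X (4 * C) r r01) => n k i.
    have := X_gauss a (t2 (dyadic n (k + delta_mx 0 i)) (dyadic n k)).
    by congr (gaussian_rv P _); apply/funext => w; rewrite incrE.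
  have -> : (fun w => (X (dyadic n (k + delta_mx 0 i)) w - X (dyadic n k) w) ^+ 2) =
      (fun w => (\sum_(k0 < 2) a k0 *
         X (t2 (dyadic n (k + delta_mx 0 i)) (dyadic n k) k0) w) ^+ 2).
    by apply/funext => w; rewrite incrE.
  apply: (Cr n i) => // x.
  rewrite /spectral_weight !big_ord_recr big_ord0 /= add0r /a /t2 /= rmorph1.
  rewrite dyadicD; set s := dyadic n k.
  have -> : 1 * wave (s + 2 ^- n *: basis_vec R i) x + real_complex R (-1) * wave s x =
      wave (s + 2 ^- n *: basis_vec R i) x - wave s x.
    by rewrite rmorphN rmorph1 mul1r mulN1r.
  rewrite wave_shift sqnM sqn_expi !mul1r.
  apply: min1_bound (sqr_ge0 _) _; rewrite ?mul1r ?ler01//; [lra|exact: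
      sqn_expiB1_le4|].
  exact: sqn_expiB1_le.
exists V; split=> // t.
have V_t : {ae P, forall w, X (dyadic n (dyadic_floor n t)) w @[n --> \oo] --> V t w}.
  by apply: filterS V_lim => w; exact.
apply: ae_prob1.
  exact: measurable_rv_eq.
pose e n := covariance_fun X (dyadic n (dyadic_floor n t)) (dyadic n (dyadic_floor n t))
  - 2 * covariance_fun X (dyadic n (dyadic_floor n t)) t + covariance_fun X t t.
apply: (ae_limit_unique (Z := fun n => X (dyadic n (dyadic_floor n t))) (e := e)) => //.
  by move=> n; rewrite (second_moment_difference X_gauss).
have tt := @dyadic_floor_cvg R N t.
have c1 : covariance_fun X (dyadic n (dyadic_floor n t)) (dyadic n
    (dyadic_floor n t)) @[n --> \oo] --> covariance_fun X t t.
  apply: (@cvg_comp _ _ _ (fun n => (dyadic n (dyadic_floor n t), dyadic n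
      (dyadic_floor n t))) (fun st => covariance_fun X st.1 st.2)); last exact:
      (X_cov (x := (t, t))).
  exact: cvg_pair_rV.
have c2' : covariance_fun X (dyadic n (dyadic_floor n t)) t @[n --> \oo] -->
    covariance_fun X t t.
  apply: (@cvg_comp _ _ _ (fun n => (dyadic n (dyadic_floor n t), t)) (fun st
      => covariance_fun X st.1 st.2)); last exact: (X_cov (x := (t, t))).
  by apply: cvg_pair_rV => //; exact: cvg_cst.
rewrite [X in _ --> X](_ : _ = covariance_fun X t t - 2 * covariance_fun X t t
    + covariance_fun X t t); last by ring.
apply: cvgD; last exact: cvg_cst.
by apply: cvgB => //; apply: cvgM => //; exact: cvg_cst.
Qed.

(** The version [Y] is given in advance, so that the same one serves every direction. The hypothesis
    on [j] is the gap for the exponent [2 / beta j]. *)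
Lemma divided_difference_version (Y : 'rV[R]_N -> {RV P >-> R}) (j : 'I_N) :
  is_version X Y -> (forall w, continuous (sample_path Y w)) ->
  2 < beta j * (gamma - Q) ->
  {ae P, forall w, exists g, divided_difference (sample_path Y w) j g}.
Proof.
move=> YX cY bj.
have tQ : 2 / beta j < gamma - Q by rewrite ltr_pdivrMr// mulrC.
have w1 (l : 'rV[R]_N) : l 0 j ^+ 2 <= 1 + dotp l l.
  by apply: (le_trans (coord_sqr_le_dotp l j)); rewrite lerDr.
have wa (l : 'rV[R]_N) : l 0 j ^+ 2 <= aniso beta l `^ (2 / beta j).
  rewrite -(real_normK (num_real (l 0 j))) -(powR_mulrn 2 (normr_ge0 _)).
  exact: coord_powR_le_aniso.
have [C [r [r01 Cr]]] := @second_moment_increment (fun l => l 0 j ^+ 2) (2 / beta j)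
  (fun l => sqr_ge0 _) (measurable_funX _ (measurable_coord j)) w1 (fun l _ => wa l) tQ.
(* The shift by 1/3 keeps the step of a divided difference away from 0 at every
   dyadic point. *)
pose h (x : 'rV[R]_(N + 1)) : R := x 0 (rshift N 0) + 3^-1.
pose p (x : 'rV[R]_(N + 1)) := lsubmx x + h x *: basis_vec R j.
have hN0 n k : h (dyadic n k) != 0 by exact: dyadic_neq_third.
(* Where [h x = 0] the inverse is 0 by convention and this variable is 0; by [hN0] no grid point is
   of that kind. *)
have mD x : measurable_fun setT (fun w => (h x)^-1 * (X (p x) w - X (lsubmx x) w)).
  by apply: measurable_funM => //; exact: measurable_funB.
have /choice[D DE] x := exists_rv (P := P) (mD x).
pose a4 x y (k : 'I_4) : R := nth 0 [:: (h x)^-1; - (h x)^-1; - (h y)^-1; (h y)^-1] k.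
pose t4 x y (k : 'I_4) : 'rV[R]_N := nth 0 [:: p x; lsubmx x; p y; lsubmx y] k.
have incrE x y w : D x w - D y w = \sum_(k < 4) a4 x y k * X (t4 x y k) w.
  by rewrite !big_ord_recr big_ord0 /= add0r !DE /a4 /t4 /=; ring.
have weightE x y l : spectral_weight (a4 x y) (t4 x y) l = sqn
   (real_complex R (h x)^-1 * (expi (dotp (lsubmx x) (row_of_tuple l)) * (expi
       (h x * row_of_tuple l 0 j) - 1)) -
    real_complex R (h y)^-1 * (expi (dotp (lsubmx y) (row_of_tuple l)) * (expi
        (h y * row_of_tuple l 0 j) - 1))).
  rewrite -!wave_shift /spectral_weight; congr sqn.
  by rewrite !big_ord_recr big_ord0 /= add0r /a4 /t4 /= !rmorphN/= /p; ring.
have [V [cV V_lim]] : exists V : 'rV[R]_(N + 1) -> {RV P >-> R},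
    (forall w, continuous (sample_path V w)) /\
    {ae P, forall w, forall x,
       D (dyadic n (dyadic_floor n x)) w @[n --> \oo] --> V x w}.
  (* 42 comes from [sqn_difference_quotient], and also dominates the constant 4 of the other
     estimates. *)
  apply: (@kolmogorov_continuity _ _ _ _ _ D (42 * C) r r01) => n k i.
    have := X_gauss (a4 (dyadic n (k + delta_mx 0 i)) (dyadic n k))
      (t4 (dyadic n (k + delta_mx 0 i)) (dyadic n k)).
    by congr (gaussian_rv P _); apply/funext => w; rewrite incrE.
  have -> : (fun w => (D (dyadic n (k + delta_mx 0 i)) w - D (dyadic n k) w) ^+ 2) =
      (fun w => (\sum_(k0 < 4) a4 (dyadic n (k + delta_mx 0 i)) (dyadic n k) k0 *
         X (t4 (dyadic n (k + delta_mx 0 i)) (dyadic n k) k0) w) ^+ 2).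
    by apply/funext => w; rewrite incrE.
  have hx0 := hN0 n (k + delta_mx 0 i); have hy0 := hN0 n k.
  rewrite dyadicD in hx0 *; move: hx0 hy0; set y := dyadic n k.
  have [[i0 ->]|[i0 ->]] : (exists i0, i = lshift 1 i0) \/ (exists i0, i = rshift N i0).
  - by case: (split_ordP i) => i0 ->; [left|right]; exists i0.
  (* A step in the base point: the weight is a quotient, at most [l 0 j ^+ 2], times an exponential
     increment in direction [i0]. *)
  - move=> _ hy0; apply: (Cr n i0) => // x.
    rewrite weightE /h lsubmx_shiftl last_shiftl -/(h y) dotpD expiD dotp_basis.
    set Z := expi (h y * _) - 1; set E := expi (dotp _ _); set F := expi (2 ^- n * _).
    have -> : real_complex R (h y)^-1 * (E * F * Z) - real_complex R (h y)^-1 *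
        (E * Z) =
        (real_complex R (h y)^-1 * Z) * (E * (F - 1)) by ring.
    rewrite sqnM [sqn (E * _)]sqnM sqn_expi mul1r mulrCA.
    apply: ler_pM; rewrite ?sqn_ge0 ?sqn_quotient_le//.
    by apply: min1_bound (sqr_ge0 _) _; rewrite ?mul1r ?sqn_expiB1_le//;
      try lra; apply: (le_trans (sqn_expiB1_le4 _)); lra.
  (* A step in [h] acts through the frequency coordinate [j]: when [2 ^- n * z] is at least 1 in
     modulus the two quotients are bounded separately, otherwise the Lipschitz bound applies. *)
  - move=> hx0 hy0; apply: (Cr n j) => // x.
    rewrite weightE lsubmx_shiftr.
    rewrite mulrCA [X in sqn (_ - X)]mulrCA -mulrBr sqnM sqn_expi mul1r.
    have hxy : h (y + 2 ^- n *: basis_vec R (rshift N i0)) - h y = 2 ^- n.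
      by rewrite /h last_shiftr; ring.
    set z := row_of_tuple x 0 j.
    have := sqn_difference_quotient z hx0 hy0; rewrite hxy => dq.
    have := sqnB_le (real_complex R (h (y + 2 ^- n *: basis_vec R (rshift N i0)))^-1 *
      (expi (h (y + 2 ^- n *: basis_vec R (rshift N i0)) * z) - 1))
      (real_complex R (h y)^-1 * (expi (h y * z) - 1)).
    have := sqn_quotient_le z hx0; have := sqn_quotient_le z hy0.
    move: dq; set S := sqn (_ - _) => dq q1 q2 q3.
    have z0 := sqr_ge0 z.
    have [_|_] := leP 1 ((2 ^- n * z) ^+ 2); first by rewrite mulr1; lra.
    by apply: (le_trans dq); rewrite le_eqVlt; apply/orP; left; apply/eqP; ring.
pose good w := (forall n k, V (dyadic n k) w = D (dyadic n k) w) /\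
  (forall n k, Y (lsubmx (dyadic n k)) w = X (lsubmx (dyadic n k)) w /\
     Y (p (dyadic n k)) w = X (p (dyadic n k)) w).
have : {ae P, forall w, good w}.
  (* At a grid point the approximating sequence is eventually constant. *)
  have ae1 : {ae P, forall w, forall n k, V (dyadic n k) w = D (dyadic n k) w}.
    apply: filterS V_lim => w Vw n k.
    apply: (cvg_unique (@Rhausdorff R) (Vw (dyadic n k))).
    have : D (dyadic n k) w @[q --> \oo] --> D (dyadic n k) w by exact: cvg_cst.
    apply: cvg_trans; apply: near_eq_cvg; near=> q.
    by rewrite dyadic_floorK//; near: q; exact: nbhs_infty_ge.
  have ae2 : {ae P, forall w, forall nk : nat * 'rV[int]_(N + 1),
      Y (lsubmx (dyadic nk.1 nk.2)) w = X (lsubmx (dyadic nk.1 nk.2)) w /\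
      Y (p (dyadic nk.1 nk.2)) w = X (p (dyadic nk.1 nk.2)) w}.
    by apply: ae_forall_countable => nk; apply: filterI; exact: is_version_ae.
  apply: filterS (filterI ae1 ae2) => w [h1 h2]; split=> // n k.
  exact: (h2 (n, k)).
apply: filterS => w [VD YXw].
(* This undoes the shift: [(t, s)] is read at last coordinate [s - 3^-1], where [h] equals [s]. *)
exists (fun x => V (x - 3^-1 *: basis_vec R (rshift N 0)) w); split.
  move=> x; have FF : Filter (nbhs x) := nbhs_filter x.
  apply: (@cvg_comp _ _ _ (fun x => x - 3^-1 *: basis_vec R (rshift N 0)) (fun
      x => V x w)); last exact: (cV w).
  by apply: cvgB; [exact: cvg_id|exact: cvg_cst].
(* Multiplied by [h x], the identity is continuous in [x] and holds on the grid, hence everywhere,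
   including where [h x = 0]. *)
have key x : h x * V x w - (Y (p x) w - Y (lsubmx x) w) = 0.
  pose F x := h x * V x w - (Y (p x) w - Y (lsubmx x) w).
  have F0 n k : F (dyadic n k) = 0.
    have [e1 e2] := YXw n k.
    by rewrite /F VD e1 e2 DE mulrA divff ?hN0// mul1r subrr.
  pose u n := dyadic n (dyadic_floor n x) : 'rV[R]_(N + 1).
  have ux : u n @[n --> \oo] --> x by exact: dyadic_floor_cvg.
  have coord i : u n 0 i @[n --> \oo] --> x 0 i.
    have H := @cvg_comp _ _ _ u (fun M : 'rV[R]_(N + 1) => M 0 i) _ _ _ ux
        (@coord_continuous R 1 (N + 1) 0 i x).
    by move=> B xB; exact: (H B xB).
  have hu : h (u n) @[n --> \oo] --> h x by apply: cvgD; [exact: coord|exact: cvg_cst].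
  have lu : lsubmx (u n) @[n --> \oo] --> lsubmx x.
    by apply: cvg_rV => i; rewrite mxE; under eq_fun do rewrite mxE; exact: coord.
  have pu : p (u n) @[n --> \oo] --> p x.
    apply: cvg_rV => i.
    have pE y : p y 0 i = y 0 (lshift 1 i) + h y * basis_vec R j 0 i by rewrite /p !mxE.
    rewrite pE; under eq_fun do rewrite pE.
    apply: cvgD; first exact: coord.
    by apply: cvgM; [exact: hu|exact: cvg_cst].
  have Fu : F (u n) @[n --> \oo] --> F x.
    apply: cvgB.
      by apply: cvgM; [exact: hu|exact: (@cvg_comp _ _ _ u (sample_path V w) _
          _ _ ux (cV w x))].
    apply: cvgB.
      exact: (@cvg_comp _ _ _ (p \o u) (sample_path Y w) _ _ _ pu (cY w (p x))).
    exact: (@cvg_comp _ _ _ (lsubmx \o u) (sample_path Y w) _ _ _ lu (cY w (lsubmx x))).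
  have F0u : F (u n) @[n --> \oo] --> (0 : R).
    by under eq_fun do rewrite F0; exact: cvg_cst.
  exact: (cvg_unique (@Rhausdorff R) Fu F0u).
move=> t s; set x := row_pair t s - _.
have hx : h x = s by rewrite /h /x -scaleNr last_shiftr row_mxEr mxE subrK.
have tx : lsubmx x = t by rewrite /x -scaleNr lsubmx_shiftr row_mxKl.
have := key x; rewrite hx /p tx hx => /eqP; rewrite subr_eq0 => /eqP ->.
by [].
Unshelve. all: by end_near.
Qed.

End gaussian_field_regularity.

Theorem theorem4p8 (R : realType) (d : measure_display)
    (T : measurableType d) (P : probability T R) (N : nat) (N0 : (0 < N)%N)
    (X : 'rV[R]_N -> {RV P >-> R}) (f : 'rV[R]_N -> R)
    (X_sep : separable_field X)
    (X_gauss : gaussian_field X)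
    (X_centered : centered X)
    (X_incr : stationary_increments X)
    (X_0 : {ae P, forall w, X 0 w = 0})
    (X_cov : continuous
       (fun st : 'rV[R]_N * 'rV[R]_N => covariance_fun X st.1 st.2))
    (X_spec : spectral_density X f)
    (c1 c2 c3 gamma : R) (beta : 'I_N -> R)
    (c1_gt0 : 0 < c1) (c2_gt0 : 0 < c2) (c3_gt0 : 0 < c3)
    (gamma_gt0 : 0 < gamma) (beta_gt0 : forall j, 0 < beta j)
    (gamma_beta : \sum_(j < N) (beta j)^-1 < gamma)
    (f_bounds : forall l : 'rV[R]_N, c3 <= eucl l ->
       c1 / (\sum_(j < N) `|l 0 j| `^ beta j) `^ gamma <= f l
         <= c2 / (\sum_(j < N) `|l 0 j| `^ beta j) `^ gamma) :
  (forall j : 'I_N, 2 < beta j * (gamma - \sum_(i < N) (beta i)^-1) ->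
     exists Y : 'rV[R]_N -> {RV P >-> R},
       [/\ is_version X Y,
           forall w, continuous (sample_path Y w) &
           {ae P, forall w,
              (forall t, partial_derivable (sample_path Y w) j t) /\
              continuous (partial (sample_path Y w) j)}])
  /\
  ((forall j : 'I_N, 2 < beta j * (gamma - \sum_(i < N) (beta i)^-1)) ->
     exists Y : 'rV[R]_N -> {RV P >-> R},
       is_version X Y /\
       {ae P, forall w,
          (forall t j, partial_derivable (sample_path Y w) j t) /\
          (forall u t : 'rV[R]_N, eucl u = 1 ->
             (sample_path Y w (t + h *: u) - sample_path Y w t
                - h * dotp u (gradient (sample_path Y w) t)) / h
             @[h --> 0^'] --> 0)}).
Proof.
have f_ub (l : 'rV[R]_N) : c3 <= eucl l -> f l <= c2 / aniso beta l `^ gamma.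
  by move=> /f_bounds/andP[].
(* One version is fixed before any direction; only the exceptional null sets depend on [j], and
   there are finitely many of them. *)
have [Y [YX cY]] : exists Y : 'rV[R]_N -> {RV P >-> R},
    is_version X Y /\ forall w, continuous (sample_path Y w).
  apply: (continuous_version X_gauss X_cov X_spec c2_gt0 c3_gt0 beta_gt0 f_ub).
  by rewrite subr_gt0.
have YD j : 2 < beta j * (gamma - \sum_(i < N) (beta i)^-1) ->
    {ae P, forall w, exists g, divided_difference (sample_path Y w) j g}.
  exact: (divided_difference_version X_gauss X_spec c2_gt0 c3_gt0 beta_gt0 f_ub YX cY).
split=> [j bj|bj].
  exists Y; split=> //; apply: filterS (YD j bj) => w [g yg].
  split=> [t|]; first by have [] := divided_difference_partial t yg.
  exact: divided_difference_continuous yg.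
exists Y; split=> //.
have : {ae P, forall w, forall j, exists g, divided_difference (sample_path Y w) j g}.
  by apply: ae_forall_countable => j; exact: YD.
apply: filterS => w /choice[g yg].
split=> [t j|u t _]; first by have [] := divided_difference_partial t (yg j).
exact: divided_difference_directional yg.
Qed.
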